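(* Let $R$ be a reduced Noetherian ring of characteristic $p>0$, and let $m$ be a maximal ideal of $R$ such that $R_m$ has a test element (e.g., $R_m$ is excellent). Suppose that one of the following holds: (i) $S=R^\infty$, and $Q_P^F=Q_P^*$ for all finitely generated $R$-modules $Q\subseteq P$ such that $P/Q$ is $m$-coprimary; (ii) $R$ is a domain, $S=R^+$, and $Q_P^+=Q_P^*$ for all finitely generated $R$-modules $Q\subseteq P$ such that $P/Q$ is $m$-coprimary; (iii) $R$ is an $\mathbb{N}$-graded domain, $S=R^{+\mathrm{GR}}$ or $S=R^{+\mathrm{gr}}$, and $Q_P^{+\mathrm{gr}}=Q_P^*$ for all finitely generated $R$-modules $Q\subseteq P$ such that $P/Q$ is $m$-coprimary. Then for any finitely generated $R$-modules $N\subseteq M$ and any $u\in M$, we have $u/1\in(N_m)_{M_m}^*$ (tight closure over $R_m$) if and only if $1\otimes\overline{u}$ is in the $m$-adic closure of $0$ in $S\otimes_R(M/N)$, where $\overline{u}$ is the image of $u$ in $M/N$. Moreover, if $M$ is free, then $(N_m)_{M_m}^*\cap M=\bigcap_k (N+m^kM)S\cap M$.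
   Context: All rings are commutative with identity. $N_m$, $M_m$ denote localizations at $m$. The $m$-adic closure of $0$ in an $S$-module $W$ is $\bigcap_k m^kW$. For a submodule $T$ of $M_m$, $T\cap M$ denotes the preimage of $T$ in $M$ under $M\to M_m$. For $M$ free and $L\subseteq M$, $LS$ is the $S$-submodule of $S\otimes_R M$ generated by the image of $L$, and $LS\cap M$ is its preimage under $M\hookrightarrow S\otimes_R M$. A finitely generated $R$-module is $m$-coprimary if it is killed by some power of the maximal ideal $m$. Let $A$ be a Noetherian ring of characteristic $p$ (here $A=R$ or $A=R_m$) and $q=p^e$ a power of $p$. Let $F^e:A\to A$, $a\mapsto a^q$, and for an $A$-module $M$ let $\mathbf{F}^e(M)=B\otimes_A M$ where $B$ is $A$ viewed as an $A$-module via $F^e$; since $B=A$ as a ring, $\mathbf{F}^e(M)$ is an $A$-module. For $u\in M$ write $u^q=1\otimes u\in\mathbf{F}^e(M)$, and for $N\subseteq M$ put $N_M^{[q]}=\mathrm{Im}(\mathbf{F}^e(N)\to\mathbf{F}^e(M))$. Let $A^\circ$ be the complement in $A$ of the union of the minimal primes. For finitely generated $N\subseteq M$: the tight closure $N_M^*$ is the set of $u\in M$ for which there is $c\in A^\circ$ with $cu^q\in N_M^{[q]}$ for all $q\gg1$; the Frobenius closure is $N_M^F=\{u\in M: u^q\in N_M^{[q]}\text{ for some }q\}$. A test element of $A$ is an element $c\in A^\circ$ such that for all finitely generated $A$-modules $N\subseteq M$ and all $u\in N_M^*$ one has $cu^q\in N_M^{[q]}$ for all $q=p^e\ge1$. $R^\infty$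 is the perfect closure of the reduced ring $R$, obtained by adjoining all $q$-th roots of elements of $R$ for all $q=p^e$. For a domain $R$, $R^+$ is the integral closure of $R$ in an algebraic closure of its fraction field. For an $\mathbb{N}$-graded domain $R$, $R^{+\mathrm{GR}}$ is a maximal direct limit of module-finite, $\mathbb{Q}_{\ge0}$-graded extension domains of $R$ (with gradings extending that of $R$); concretely, it is the subring of $R^+$ generated by the elements $f$ satisfying, for some $\delta\in\mathbb{Q}_{\ge0}$, a monic equation $f^t+r_1f^{t-1}+\cdots+r_t=0$ with each $r_i\in R$ zero or homogeneous of degree $i\delta$; such $f$ is homogeneous of degree $\delta$. $R^{+\mathrm{gr}}$ is the $\mathbb{N}$-graded subring of $R^{+\mathrm{GR}}$ consisting of the components of integer degree; it is a direct summand of $R^{+\mathrm{GR}}$ as an $R^{+\mathrm{gr}}$-module. Plus closure: $N_M^+=\{u\in M: 1\otimes u\in\mathrm{Im}(R^+\otimes_R N\to R^+\otimes_R M)\}$. Graded-plus closure: $N_M^{+\mathrm{gr}}=\{u\in M: 1\otimes u\in\mathrm{Im}(S\otimes_R N\to S\otimes_R M)\}$ with $S=R^{+\mathrm{GR}}$ or $S=R^{+\mathrm{gr}}$ (the two choices give the same closure). *)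

(* Defs.v *)
From HB Require Import structures.
From mathcomp Require Import all_boot all_order all_algebra.
From mathcomp Require Import ring.
From mathcomp Require Import boolp classical_sets.

Set Implicit Arguments.
Unset Strict Implicit.
Unset Printing Implicit Defensive.

Import GRing.Theory.
Local Open Scope ring_scope.
Local Open Scope quotient_scope.
Local Open Scope classical_set_scope.

Section Submodules.
Variables (R : comNzRingType) (V : lmodType R) (N : submodClosed V).

Definition submod : Type := {x : V | x \in N}.
HB.instance Definition _ := SubChoice.on submod.
HB.instance Definition _ := [SubChoice_isSubLmodule of submod by <:].

Definition incl : {linear submod -> V} := val.

Lemma submodN x : x \in N -> - x \in N.
Proof. by move=> h; rewrite -scaleN1r rpredZ. Qed.

Definition quot_eq : rel V := fun x y => x - y \in N.

Lemma quot_eq_equiv : equiv_class_of quot_eq.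
Proof.
split=> [x|x y|y x z]; rewrite /quot_eq.
- by rewrite subrr rpred0.
- by apply/idP/idP => h; rewrite -opprB submodN.
- by move=> h1 h2; rewrite -[x](addrNK y) -addrA rpredD.
Qed.
Canonical quot_eq_equivRel := EquivRelPack quot_eq_equiv.

Definition quotmod : Type := {eq_quot quot_eq}.
HB.instance Definition _ := EqQuotient.on quotmod.
HB.instance Definition _ := Choice.on quotmod.

Definition quot_pi (x : V) : quotmod := \pi x.

Lemma quot_piP x y : quot_pi x = quot_pi y <-> x - y \in N.
Proof. by split=> [/eqmodP|h]; [|apply/eqmodP]. Qed.

Lemma quot_piK (z : quotmod) : quot_pi (repr z) = z.
Proof. exact: reprK. Qed.

Definition quot_add (x y : quotmod) := quot_pi (repr x + repr y).
Definition quot_opp (x : quotmod) := quot_pi (- repr x).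
Definition quot_scale (a : R) (x : quotmod) := quot_pi (a *: repr x).

Lemma quot_repr x : repr (quot_pi x) - x \in N.
Proof. by apply/quot_piP; rewrite quot_piK. Qed.

Lemma quot_piD x y : quot_add (quot_pi x) (quot_pi y) = quot_pi (x + y).
Proof. by apply/quot_piP; rewrite opprD addrACA; apply: rpredD; apply: quot_repr. Qed.

Lemma quot_piN x : quot_opp (quot_pi x) = quot_pi (- x).
Proof. by apply/quot_piP; rewrite -opprD; apply/submodN/quot_repr. Qed.

Lemma quot_piZ a x : quot_scale a (quot_pi x) = quot_pi (a *: x).
Proof. by apply/quot_piP; rewrite -scalerBr; apply/rpredZ/quot_repr. Qed.

Lemma quot_ind (P : quotmod -> Prop) : (forall x, P (quot_pi x)) -> forall z, P z.
Proof. by move=> h z; rewrite -(quot_piK z). Qed.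

Fact quot_addA : associative quot_add.
Proof.
by do 3!elim/quot_ind=> ?; rewrite !quot_piD addrA.
Qed.
Fact quot_addC : commutative quot_add.
Proof. by do 2!elim/quot_ind=> ?; rewrite !quot_piD addrC. Qed.
Fact quot_add0 : left_id (quot_pi 0) quot_add.
Proof. by elim/quot_ind=> ?; rewrite quot_piD add0r. Qed.
Fact quot_addN : left_inverse (quot_pi 0) quot_opp quot_add.
Proof. by elim/quot_ind=> ?; rewrite quot_piN quot_piD addNr. Qed.
HB.instance Definition _ :=
  GRing.isZmodule.Build quotmod quot_addA quot_addC quot_add0 quot_addN.

Lemma quot_addE x y : quot_pi x + quot_pi y = quot_pi (x + y).
Proof. exact: quot_piD. Qed.

Fact quot_scaleA a b v : quot_scale a (quot_scale b v) = quot_scale (a * b) v.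
Proof. by elim/quot_ind: v => v; rewrite !quot_piZ scalerA. Qed.
Fact quot_scale1 : left_id 1 quot_scale.
Proof. by elim/quot_ind=> v; rewrite quot_piZ scale1r. Qed.
Fact quot_scaleDr : right_distributive quot_scale +%R.
Proof.
move=> a; do 2!elim/quot_ind=> ?.
by rewrite quot_addE !quot_piZ quot_addE scalerDr.
Qed.
Fact quot_scaleDl v : {morph quot_scale^~ v : a b / a + b}.
Proof.
elim/quot_ind: v => v a b.
by rewrite !quot_piZ quot_addE scalerDl.
Qed.
HB.instance Definition _ := GRing.Zmodule_isLmodule.Build R quotmod
  quot_scaleA quot_scale1 quot_scaleDr quot_scaleDl.

Lemma quot_scaleE a x : a *: quot_pi x = quot_pi (a *: x).
Proof. exact: quot_piZ. Qed.

End Submodules.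

Definition fingen (R : comNzRingType) (V : lmodType R) : Prop :=
  exists s : seq V, forall v, exists c : nat -> R,
    v = \sum_(i < size s) c i *: s`_i.

Definition is_free (R : comNzRingType) (V : lmodType R) : Prop :=
  exists B : set V,
    (forall v, exists (s : seq V) (c : V -> R),
        (forall x, x \in s -> B x) /\ v = \sum_(x <- s) c x *: x) /\
    (forall (s : seq V) (c : V -> R),
        uniq s -> (forall x, x \in s -> B x) ->
        \sum_(x <- s) c x *: x = 0 -> forall x, x \in s -> c x = 0).

Definition is_noetherian (R : comNzRingType) : Prop :=
  forall I : submodClosed R^o, fingen (submod I).

Definition is_reduced (R : comNzRingType) : Prop :=
  forall (x : R) n, x ^+ n = 0 -> x = 0.

(* The proper ideals of [R] are the inhabitants of [idealr R]. *)
Definition is_maximal (R : comNzRingType) (m : {pred R}) : Prop :=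
  forall I : idealr R, {subset m <= I} -> {subset I <= m}.

Definition minimal_prime (A : comNzRingType) (P : prime_idealr A) : Prop :=
  forall Q : prime_idealr A, {subset Q <= P} -> {subset P <= Q}.

(* The set A° *)
Definition off_minimal_primes (A : comNzRingType) : set A :=
  [set c | forall P : prime_idealr A, minimal_prime P -> c \notin P].

Definition finite_sums (V : nmodType) (X : set V) : set V :=
  [set v | exists s : seq V, (forall x, x \in s -> X x) /\ v = \sum_(x <- s) x].

Fixpoint ideal_power (R : comNzRingType) (I : set R) (k : nat) : set R :=
  if k is k'.+1
  then finite_sums [set a * b | a in I & b in ideal_power I k']
  else setT.

(* The submodule XW of a module W over a ring A, for a subset X of A; for an
   R-algebra f : R -> A and an ideal I of R, IW is [mulset (f @` I) W]. *)
Definition mulset (A : comNzRingType) (X : set A) (W : lmodType A) : set W :=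
  finite_sums [set a *: w | a in X & w in setT].
Arguments mulset {A} X W.

Definition is_coprimary (R : comNzRingType) (m : {pred R}) (V : lmodType R) :
    Prop :=
  fingen V /\
  exists k, forall a (v : V), ideal_power [set` m] k a -> a *: v = 0.

Section Tensor.
Variables (R S : comNzRingType) (phi : {rmorphism R -> S}) (M : lmodType R).

(* S ⊗_R M: formal finite sums of pairs (s, x), modulo the congruence generated
   by the bilinearity relations, where S is an R-module through [phi]. *)
Inductive tens_rel : seq (S * M) -> seq (S * M) -> Prop :=
| tens_refl a : tens_rel a a
| tens_sym a b : tens_rel a b -> tens_rel b a
| tens_trans b a c : tens_rel a b -> tens_rel b c -> tens_rel a c
| tens_cat a a' b b' :
    tens_rel a a' -> tens_rel b b' -> tens_rel (a ++ b) (a' ++ b')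
| tens_catC a b : tens_rel (a ++ b) (b ++ a)
| tens_zero x : tens_rel [:: (0, x)] [::]
| tens_Dl s t x : tens_rel [:: (s + t, x)] [:: (s, x); (t, x)]
| tens_Dr s x y : tens_rel [:: (s, x + y)] [:: (s, x); (s, y)]
| tens_bal s r x : tens_rel [:: (s * phi r, x)] [:: (s, r *: x)].

Definition tens_eq : rel (seq (S * M)) := fun a b => `[< tens_rel a b >].

Lemma tens_eq_equiv : equiv_class_of tens_eq.
Proof.
split=> [a|a b|b a c]; rewrite /tens_eq.
- exact/asboolP/tens_refl.
- by apply/asboolP/asboolP; apply: tens_sym.
- by move=> /asboolP h1 /asboolP h2; apply/asboolP; apply: tens_trans h1 h2.
Qed.
Canonical tens_eq_equivRel := EquivRelPack tens_eq_equiv.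

Definition tensor : Type := {eq_quot tens_eq}.
HB.instance Definition _ := EqQuotient.on tensor.
HB.instance Definition _ := Choice.on tensor.

Definition tens_pi (a : seq (S * M)) : tensor := \pi a.

Definition tens (s : S) (x : M) : tensor := tens_pi [:: (s, x)].

Lemma tens_piP a b : tens_pi a = tens_pi b <-> tens_rel a b.
Proof.
by split=> [/eqmodP/asboolP|h]; [|apply/eqmodP/asboolP].
Qed.

Lemma tens_piK (z : tensor) : tens_pi (repr z) = z.
Proof. exact: reprK. Qed.

Lemma tens_repr a : tens_rel (repr (tens_pi a)) a.
Proof. by apply/tens_piP; rewrite tens_piK. Qed.

Lemma tens_ind (P : tensor -> Prop) : (forall a, P (tens_pi a)) -> forall z, P z.
Proof. by move=> h z; rewrite -(tens_piK z). Qed.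

Definition seq_scale (c : S) (a : seq (S * M)) : seq (S * M) :=
  [seq (c * u.1, u.2) | u <- a].

Definition tens_add (x y : tensor) := tens_pi (repr x ++ repr y).
Definition tens_scale (c : S) (x : tensor) := tens_pi (seq_scale c (repr x)).
Definition tens_opp (x : tensor) := tens_scale (-1) x.

Lemma seq_scale_rel c a b :
  tens_rel a b -> tens_rel (seq_scale c a) (seq_scale c b).
Proof.
elim=> {a b} //=.
- by move=> a; apply: tens_refl.
- by move=> a b _; apply: tens_sym.
- by move=> b a d _ h1 _ h2; apply: tens_trans h1 h2.
- by move=> a a' b b' _ h1 _ h2; rewrite /seq_scale !map_cat; apply: tens_cat.
- by move=> a b; rewrite /seq_scale !map_cat; apply: tens_catC.
- by move=> x; rewrite mulr0; apply: tens_zero.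
- by move=> s t x; rewrite mulrDr; apply: tens_Dl.
- by move=> s x y; apply: tens_Dr.
- by move=> s r x; rewrite mulrA; apply: tens_bal.
Qed.

Lemma tens_piD a b : tens_add (tens_pi a) (tens_pi b) = tens_pi (a ++ b).
Proof. by apply/tens_piP; apply: tens_cat; apply: tens_repr. Qed.

Lemma tens_piZ c a : tens_scale c (tens_pi a) = tens_pi (seq_scale c a).
Proof. by apply/tens_piP; apply/seq_scale_rel/tens_repr. Qed.

Lemma seq_scaleDl c d a :
  tens_rel (seq_scale (c + d) a) (seq_scale c a ++ seq_scale d a).
Proof.
elim: a => [|[s x] a IH] /=; first exact: tens_refl.
rewrite -cat1s -[(c * s, x) :: _]cat1s mulrDl.
apply: (tens_trans (tens_cat (tens_Dl _ _ _) IH)) => /=.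
rewrite -[(c * s, x) :: _]cat1s -[X in tens_rel _ X]cat1s.
apply: tens_cat; first exact: tens_refl.
rewrite -cat1s catA -[X in tens_rel _ (_ ++ X)]cat1s catA.
by apply: tens_cat (tens_catC _ _) (tens_refl _).
Qed.

Lemma seq_scale0 a : tens_rel (seq_scale 0 a) [::].
Proof.
elim: a => [|[s x] a IH] /=; first exact: tens_refl.
rewrite mul0r -cat1s -[X in tens_rel _ X]cat0s.
exact: tens_cat (tens_zero _) IH.
Qed.

Lemma seq_scale1 a : seq_scale 1 a = a.
Proof. by rewrite -[RHS]map_id; apply: eq_map => -[s x] /=; rewrite mul1r. Qed.

Fact tens_addA : associative tens_add.
Proof. by do 3!elim/tens_ind=> ?; rewrite !tens_piD catA. Qed.
Fact tens_addC : commutative tens_add.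
Proof.
do 2!elim/tens_ind=> ?; rewrite !tens_piD.
exact/tens_piP/tens_catC.
Qed.
Fact tens_add0 : left_id (tens_pi [::]) tens_add.
Proof. by elim/tens_ind=> ?; rewrite tens_piD. Qed.
Fact tens_addN : left_inverse (tens_pi [::]) tens_opp tens_add.
Proof.
elim/tens_ind=> a; rewrite /tens_opp tens_piZ tens_piD; apply/tens_piP.
rewrite -{2}[a]seq_scale1.
apply: (tens_trans (tens_sym (seq_scaleDl _ _ _))).
rewrite addNr; exact: seq_scale0.
Qed.
HB.instance Definition _ :=
  GRing.isZmodule.Build tensor tens_addA tens_addC tens_add0 tens_addN.

Lemma tens_addE a b : tens_pi a + tens_pi b = tens_pi (a ++ b).
Proof. exact: tens_piD. Qed.

Fact tens_scaleA a b v : tens_scale a (tens_scale b v) = tens_scale (a * b) v.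
Proof.
elim/tens_ind: v => v; rewrite !tens_piZ /seq_scale -map_comp.
by congr tens_pi; apply: eq_map => u /=; rewrite mulrA.
Qed.
Fact tens_scale1 : left_id 1 tens_scale.
Proof. by elim/tens_ind=> v; rewrite tens_piZ seq_scale1. Qed.
Fact tens_scaleDr : right_distributive tens_scale +%R.
Proof.
move=> a; do 2!elim/tens_ind=> ?.
by rewrite tens_addE !tens_piZ tens_addE /seq_scale map_cat.
Qed.
Fact tens_scaleDl v : {morph tens_scale^~ v : a b / a + b}.
Proof.
elim/tens_ind: v => v a b.
by rewrite !tens_piZ tens_addE; apply/tens_piP/seq_scaleDl.
Qed.
HB.instance Definition _ := GRing.Zmodule_isLmodule.Build S tensor
  tens_scaleA tens_scale1 tens_scaleDr tens_scaleDl.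

Lemma tens_scaleE c a : c *: tens_pi a = tens_pi (seq_scale c a).
Proof. exact: tens_piZ. Qed.

End Tensor.

Section TensorMap.
Variables (R S : comNzRingType) (phi : {rmorphism R -> S}).
Variables (M M' : lmodType R) (f : {linear M -> M'}).

Definition seq_tmap (a : seq (S * M)) : seq (S * M') :=
  [seq (u.1, f u.2) | u <- a].

(* S ⊗ f : S ⊗_R M -> S ⊗_R M' *)
Definition tens_map (z : tensor phi M) : tensor phi M' :=
  tens_pi phi (seq_tmap (repr z)).

Lemma seq_tmap_rel a b :
  tens_rel phi a b -> tens_rel phi (seq_tmap a) (seq_tmap b).
Proof.
elim=> {a b} //=.
- by move=> a; apply: tens_refl.
- by move=> a b _; apply: tens_sym.
- by move=> b a d _ h1 _ h2; apply: tens_trans h1 h2.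
- by move=> a a' b b' _ h1 _ h2; rewrite /seq_tmap !map_cat; apply: tens_cat.
- by move=> a b; rewrite /seq_tmap !map_cat; apply: tens_catC.
- by move=> x; apply: tens_zero.
- by move=> s t x; apply: tens_Dl.
- by move=> s x y; rewrite linearD; apply: tens_Dr.
- by move=> s r x; rewrite linearZ; apply: tens_bal.
Qed.

Lemma tens_map_pi a : tens_map (tens_pi phi a) = tens_pi phi (seq_tmap a).
Proof. by apply/tens_piP; apply/seq_tmap_rel/tens_repr. Qed.

Lemma tens_mapE s x : tens_map (tens phi s x) = tens phi s (f x).
Proof. exact: tens_map_pi. Qed.

Lemma tens_map_linear : linear tens_map.
Proof.
move=> c; do 2!elim/tens_ind=> ?.
rewrite tens_scaleE tens_addE !tens_map_pi.
rewrite tens_scaleE tens_addE /seq_tmap map_cat /seq_scale.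
by rewrite -!map_comp.
Qed.
HB.instance Definition _ := GRing.isLinear.Build S _ _ _ tens_map tens_map_linear.

End TensorMap.

Arguments tens_map {R S} phi {M M'} f z.

(* Im(S ⊗_R N -> S ⊗_R M) *)
Definition tens_image (R S : comNzRingType) (phi : {rmorphism R -> S})
    (M : lmodType R) (N : submodClosed M) : set (tensor phi M) :=
  range (tens_map phi (incl N)).

(* The submodule LS of S ⊗_R M, for a subset L of M *)
Definition extended (R S : comNzRingType) (phi : {rmorphism R -> S})
    (M : lmodType R) (L : set M) : set (tensor phi M) :=
  finite_sums [set s *: tens phi 1 x | s in setT & x in L].

(* The m-adic closure of 0 in W *)
Definition adic_closure0 (R S : comNzRingType) (phi : {rmorphism R -> S})
    (m : {pred R}) (W : lmodType S) : set W :=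
  \bigcap_k mulset (phi @` ideal_power [set` m] k) W.

Arguments tens_image {R S} phi {M} N.
Arguments extended {R S} phi {M} L.
Arguments adic_closure0 {R S} phi m {W}.

Section Localization.
Variables (R : comNzRingType) (m : prime_idealr R).

Definition denom : Type := {s : R | s \notin m}.
HB.instance Definition _ := SubChoice.on denom.

Fact denom1_subproof : 1 \notin m.
Proof. by rewrite idealr1. Qed.
Definition denom1 : denom := exist (fun s => s \notin m) 1 denom1_subproof.

Fact denomM_subproof (s t : denom) : val s * val t \notin m.
Proof. by rewrite prime_idealrM negb_or (valP s) (valP t). Qed.
Definition denomM (s t : denom) : denom := exist (fun s => s \notin m) _ (denomM_subproof s t).

Section Module.
Variable M : lmodType R.

Definition loc_rel (a b : M * denom) : Prop :=
  exists w : denom, val w *: (val b.2 *: a.1) = val w *: (val a.2 *: b.1).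

Definition loc_eq : rel (M * denom) := fun a b => `[< loc_rel a b >].

Lemma loc_eq_equiv : equiv_class_of loc_eq.
Proof.
split=> [a|a b|b a c]; rewrite /loc_eq.
- by apply/asboolP; exists denom1.
- by apply/asboolP/asboolP => -[w e]; exists w.
- move=> /asboolP[w e] /asboolP[w' e']; apply/asboolP.
  exists (denomM (denomM w w') b.2) => /=.
  move: a b c w w' e e' => [x [s hs]] [y [t ht]] [z [u hu]] [w hw] [w' hw'] /=.
  move=> e e'; rewrite !scalerA in e e' *.
  have -> : w * w' * t * u = (w' * u) * (w * t) by ring.
  have -> : w * w' * t * s = (w * s) * (w' * t) by ring.
  rewrite -scalerA e -[RHS]scalerA -e' !scalerA; congr (_ *: _); ring.
Qed.
Canonical loc_eq_equivRel := EquivRelPack loc_eq_equiv.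

Definition loc : Type := {eq_quot loc_eq}.
HB.instance Definition _ := EqQuotient.on loc.
HB.instance Definition _ := Choice.on loc.

Definition frac (x : M) (s : denom) : loc := \pi_loc (x, s).

(* x/1 *)
Definition loc_in (x : M) : loc := frac x denom1.

Lemma fracP x s y t :
  frac x s = frac y t <->
  exists w : denom, val w *: (val t *: x) = val w *: (val s *: y).
Proof.
by split=> [/eqmodP/asboolP|h]; [|apply/eqmodP/asboolP].
Qed.

Lemma frac_ind (P : loc -> Prop) : (forall x s, P (frac x s)) -> forall z, P z.
Proof.
by move=> h z; rewrite -(reprK z); move: (repr z) => [x s]; apply: h.
Qed.

Lemma frac_repr x s :
  exists w : denom, val w *: (val s *: (repr (frac x s)).1) =
                    val w *: (val (repr (frac x s)).2 *: x).
Proof.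
apply/fracP; rewrite -[RHS]reprK.
by rewrite [in RHS](surjective_pairing (repr (frac x s))).
Qed.

Definition loc_add (a b : loc) : loc :=
  frac (val (repr b).2 *: (repr a).1 + val (repr a).2 *: (repr b).1)
       (denomM (repr a).2 (repr b).2).
Definition loc_opp (a : loc) : loc := frac (- (repr a).1) (repr a).2.

Lemma loc_fracD x s y t :
  loc_add (frac x s) (frac y t) = frac (val t *: x + val s *: y) (denomM s t).
Proof.
have [w e] := frac_repr x s; have [w' e'] := frac_repr y t.
rewrite /loc_add.
move: (repr (frac x s)) (repr (frac y t)) e e' => [x1 s1] [y1 t1] /= e e'.
apply/fracP; exists (denomM w w') => /=.
rewrite !scalerDr !scalerA in e e' *; congr (_ + _).
  have -> : val w * val w' * (val s * val t) * val t1 =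
    (val w' * val t * val t1) * (val w * val s) by ring.
  have -> : val w * val w' * (val s1 * val t1) * val t =
    (val w' * val t * val t1) * (val w * val s1) by ring.
  by rewrite -scalerA e scalerA.
have -> : val w * val w' * (val s * val t) * val s1 =
  (val w * val s * val s1) * (val w' * val t) by ring.
have -> : val w * val w' * (val s1 * val t1) * val s =
  (val w * val s * val s1) * (val w' * val t1) by ring.
by rewrite -scalerA e' scalerA.
Qed.

Lemma loc_fracN x s : loc_opp (frac x s) = frac (- x) s.
Proof.
have [w e] := frac_repr x s; rewrite /loc_opp.
by apply/fracP; exists w; rewrite !scalerN e.
Qed.

Fact loc_addA : associative loc_add.
Proof.
elim/frac_ind=> x s; elim/frac_ind=> y t; elim/frac_ind=> z u.
rewrite !loc_fracD; apply/fracP; exists denom1.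
rewrite /= !scalerDr !scalerA addrA.
by congr (_ *: _ + _ *: _ + _ *: _); ring.
Qed.
Fact loc_addC : commutative loc_add.
Proof.
elim/frac_ind=> x s; elim/frac_ind=> y t.
rewrite !loc_fracD; apply/fracP; exists denom1.
by rewrite /= [in RHS]addrC [val s * _]mulrC.
Qed.
Fact loc_add0 : left_id (loc_in 0) loc_add.
Proof.
elim/frac_ind=> x s; rewrite loc_fracD; apply/fracP; exists denom1.
by rewrite /= scaler0 add0r !scale1r mul1r.
Qed.
Fact loc_addN : left_inverse (loc_in 0) loc_opp loc_add.
Proof.
elim/frac_ind=> x s; rewrite loc_fracN loc_fracD; apply/fracP; exists denom1.
by rewrite /= scalerN addNr !scaler0.
Qed.
HB.instance Definition _ :=
  GRing.isZmodule.Build loc loc_addA loc_addC loc_add0 loc_addN.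

Lemma frac_addE x s y t :
  frac x s + frac y t = frac (val t *: x + val s *: y) (denomM s t).
Proof. exact: loc_fracD. Qed.

End Module.

(* R_m *)
Definition locring : Type := loc R^o.
HB.instance Definition _ := GRing.Zmodule.on locring.

Definition lfrac (a : R) (s : denom) : locring := frac (a : R^o) s.

Lemma lfracP a s b t :
  lfrac a s = lfrac b t <->
  exists w : denom, val w * (val t * a) = val w * (val s * b).
Proof. exact: (@fracP R^o). Qed.

Lemma lfrac_ind (P : locring -> Prop) :
  (forall a s, P (lfrac a s)) -> forall z, P z.
Proof. exact: (@frac_ind R^o). Qed.

Lemma lfrac_addE a s b t :
  lfrac a s + lfrac b t = lfrac (val t * a + val s * b) (denomM s t).
Proof. exact: (@frac_addE R^o). Qed.

Definition lfrac_num (a : locring) : R := (repr (a : loc R^o)).1.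
Definition lfrac_den (a : locring) : denom := (repr (a : loc R^o)).2.

Lemma lfrac_repr a s :
  exists w : denom, val w * (val s * lfrac_num (lfrac a s)) =
                    val w * (val (lfrac_den (lfrac a s)) * a).
Proof. exact: (@frac_repr R^o). Qed.

(* (a/s)(x/t) = (ax)/(st) *)
Definition loc_scale (M : lmodType R) (a : locring) (z : loc M) : loc M :=
  frac (lfrac_num a *: (repr z).1) (denomM (lfrac_den a) (repr z).2).

Lemma loc_fracZ (M : lmodType R) a s (x : M) t :
  loc_scale (lfrac a s) (frac x t) = frac (a *: x) (denomM s t).
Proof.
have [w e] := lfrac_repr a s; have [w' e'] := frac_repr x t.
rewrite /loc_scale.
move: (lfrac_num _) (lfrac_den _) (repr (frac x t)) e e' => a1 s1 [x1 t1] /= e e'.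
apply/fracP; exists (denomM w w') => /=.
rewrite !scalerA in e' *.
have -> : val w * val w' * (val s * val t) * a1 =
  (val w * (val s * a1)) * (val w' * val t) by ring.
have -> : val w * val w' * (val s1 * val t1) * a =
  (val w * (val s1 * a)) * (val w' * val t1) by ring.
by rewrite e -2!scalerA e' !scalerA.
Qed.

Definition loc_mul (a b : locring) : locring := loc_scale a (b : loc R^o).
Definition loc_one : locring := lfrac 1 denom1.

Lemma lfracM a s b t : loc_mul (lfrac a s) (lfrac b t) = lfrac (a * b) (denomM s t).
Proof. exact: loc_fracZ. Qed.

Fact loc_mulA : associative loc_mul.
Proof.
elim/lfrac_ind=> x s; elim/lfrac_ind=> y t; elim/lfrac_ind=> z u.
by rewrite !lfracM; apply/lfracP; exists denom1 => /=; ring.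
Qed.
Fact loc_mulC : commutative loc_mul.
Proof.
elim/lfrac_ind=> x s; elim/lfrac_ind=> y t.
by rewrite !lfracM; apply/lfracP; exists denom1 => /=; ring.
Qed.
Fact loc_mul1 : left_id loc_one loc_mul.
Proof.
elim/lfrac_ind=> x s.
by rewrite lfracM; apply/lfracP; exists denom1 => /=; ring.
Qed.
Fact loc_mulDl : left_distributive loc_mul +%R.
Proof.
elim/lfrac_ind=> x s; elim/lfrac_ind=> y t; elim/lfrac_ind=> z u.
rewrite lfrac_addE !lfracM lfrac_addE.
by apply/lfracP; exists denom1 => /=; ring.
Qed.
Fact loc_one_neq0 : loc_one != 0.
Proof.
apply/eqP => /lfracP[[w hw]] /=; rewrite !mulr0 !mulr1 => e.
by move: hw; rewrite e rpred0.
Qed.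
HB.instance Definition _ := GRing.Zmodule_isComNzRing.Build locring
  loc_mulA loc_mulC loc_mul1 loc_mulDl loc_one_neq0.

Lemma lfrac_mulE a s b t : lfrac a s * lfrac b t = lfrac (a * b) (denomM s t).
Proof. exact: lfracM. Qed.

Section Scale.
Variable M : lmodType R.

Fact loc_scaleA (a b : locring) (z : loc M) :
  loc_scale a (loc_scale b z) = loc_scale (a * b) z.
Proof.
elim/lfrac_ind: a => a s; elim/lfrac_ind: b => b t; elim/frac_ind: z => x u.
rewrite lfrac_mulE !loc_fracZ; apply/fracP; exists denom1.
by rewrite /= !scalerA; congr (_ *: _); ring.
Qed.
Fact loc_scale1 : left_id 1 (@loc_scale M).
Proof.
elim/frac_ind=> x s; rewrite loc_fracZ; apply/fracP; exists denom1.
by rewrite /= !scalerA; congr (_ *: _); ring.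
Qed.
Fact loc_scaleDr : right_distributive (@loc_scale M) +%R.
Proof.
elim/lfrac_ind=> a s; elim/frac_ind=> x t; elim/frac_ind=> y u.
rewrite frac_addE !loc_fracZ frac_addE; apply/fracP; exists denom1.
by rewrite /= !scalerDr !scalerA; congr (_ *: _ + _ *: _); ring.
Qed.
Fact loc_scaleDl (z : loc M) : {morph (@loc_scale M)^~ z : a b / a + b}.
Proof.
elim/frac_ind: z => x u; elim/lfrac_ind=> a s; elim/lfrac_ind=> b t.
rewrite lfrac_addE !loc_fracZ frac_addE; apply/fracP; exists denom1.
by rewrite /= !scalerA -scalerDl scalerA; congr (_ *: _); ring.
Qed.
HB.instance Definition _ := GRing.Zmodule_isLmodule.Build locring (loc M)
  loc_scaleA loc_scale1 loc_scaleDr loc_scaleDl.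

Lemma frac_scaleE a s (x : M) t :
  lfrac a s *: frac x t = frac (a *: x) (denomM s t).
Proof. exact: loc_fracZ. Qed.

(* N_m, as a submodule of M_m *)
Variable N : submodClosed M.
Definition loc_sub : {pred loc M} :=
  fun z => `[< exists2 x, x \in N & exists s, z = frac x s >].

Lemma loc_subP z :
  reflect (exists2 x, x \in N & exists s, z = frac x s) (z \in loc_sub).
Proof. exact: asboolP. Qed.

Fact loc_sub_closed : GRing.subsemimod_closed loc_sub.
Proof.
split; first split.
- by apply/loc_subP; exists 0; [exact: rpred0 | exists denom1].
- move=> _ _ /loc_subP[x Nx [s ->]] /loc_subP[y Ny [t ->]].
  rewrite frac_addE; apply/loc_subP; eexists; last by eexists.
  by apply: rpredD; apply: rpredZ.
- elim/lfrac_ind=> a s _ /loc_subP[y Ny [t ->]].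
  rewrite frac_scaleE; apply/loc_subP; eexists; last by eexists.
  exact: rpredZ.
Qed.
HB.instance Definition _ :=
  GRing.isSubSemiModClosed.Build locring (loc M) loc_sub loc_sub_closed.

End Scale.

Definition to_locring (a : R) : locring := lfrac a denom1.

Fact to_locring_is_zmod_morphism : zmod_morphism to_locring.
Proof.
move=> a b; apply/eqP; rewrite eq_sym subr_eq; apply/eqP.
rewrite lfrac_addE; apply/lfracP; exists denom1 => /=; ring.
Qed.
Fact to_locring_is_monoid_morphism : monoid_morphism to_locring.
Proof.
split=> // a b; rewrite lfrac_mulE; apply/lfracP; exists denom1 => /=; ring.
Qed.
HB.instance Definition _ :=
  GRing.isZmodMorphism.Build R locring to_locring to_locring_is_zmod_morphism.
HB.instance Definition _ :=
  GRing.isMonoidMorphism.Build R locring to_locring to_locring_is_monoid_morphism.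

Lemma locring_pchar p : p \in [pchar R] -> p \in [pchar locring].
Proof. exact: (rmorph_pchar to_locring). Qed.

End Localization.

Arguments locring {R} m.
Arguments loc {R} m M.
Arguments loc_in {R} m {M} x.
Arguments loc_sub {R} m {M} N.

Section TightClosure.
Variables (p : nat) (A : comNzRingType) (chA : p \in [pchar A]).

(* The proof argument makes [frob chA e] a ring morphism. *)
Definition frob of p \in [pchar A] := fun (e : nat) (a : A) => a ^+ (p ^ e).

Fact frob_is_nmod_morphism e : nmod_morphism (frob chA e).
Proof.
split=> [|a b]; rewrite /frob.
  by rewrite expr0n expn_eq0 eqn0Ngt prime_gt0 ?(pcharf_prime chA).
apply: exprDn_pchar; rewrite (eq_pnat _ (pcharf_eq chA)).
by rewrite pnatX pnat_id ?(pcharf_prime chA).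
Qed.
Fact frob_is_monoid_morphism e : monoid_morphism (frob chA e).
Proof. by split=> [|a b]; rewrite /frob ?expr1n ?exprMn. Qed.
HB.instance Definition _ e :=
  GRing.isNmodMorphism.Build A A (frob chA e) (frob_is_nmod_morphism e).
HB.instance Definition _ e :=
  GRing.isMonoidMorphism.Build A A (frob chA e) (frob_is_monoid_morphism e).

(* F^e(M), with u^q = [frob_in e u] and N_M^[q] = [frob_sub e N] for q = p^e *)
Definition frob_mod (e : nat) (M : lmodType A) : lmodType A :=
  tensor (frob chA e) M.

Definition frob_in (e : nat) (M : lmodType A) (u : M) : frob_mod e M :=
  tens (frob chA e) 1 u.

Definition frob_sub (e : nat) (M : lmodType A) (N : submodClosed M) :
  set (frob_mod e M) := tens_image (frob chA e) N.

Arguments frob_in e {M} u.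
Arguments frob_sub e {M} N.

Definition tight_closure (M : lmodType A) (N : submodClosed M) : set M :=
  [set u | exists2 c, off_minimal_primes c &
    exists e0, forall e, (e0 <= e)%N -> frob_sub e N (c *: frob_in e u)].

Definition frobenius_closure (M : lmodType A) (N : submodClosed M) : set M :=
  [set u | exists e, frob_sub e N (frob_in e u)].

Definition is_test_element (c : A) : Prop :=
  off_minimal_primes c /\
  forall (M : lmodType A) (N : submodClosed M),
    fingen M -> fingen (submod N) ->
    forall u, tight_closure N u -> forall e, frob_sub e N (c *: frob_in e u).

End TightClosure.

Arguments frob_in {p A} chA e {M} u.
Arguments frob_sub {p A} chA e {M} N.
Arguments tight_closure {p A} chA {M} N.
Arguments frobenius_closure {p A} chA {M} N.
Arguments is_test_element {p A} chA c.

(* {u in M : 1 ⊗ u in Im(S ⊗_R N -> S ⊗_R M)}; this is the plus closure for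
   S = R^+, and the graded-plus closure for S = R^{+GR} or S = R^{+gr}. *)
Definition tens_closure (R S : comNzRingType) (iota : {rmorphism R -> S})
    (M : lmodType R) (N : submodClosed M) : set M :=
  [set u | tens_image iota N (tens iota 1 u)].

Arguments tens_closure {R S} iota {M} N.

(* Each is determined up to isomorphism of R-algebras; the predicates below say
   that [iota : R -> S] is one of them. *)

Definition is_perfect_closure (p : nat) (R S : comNzRingType)
    (iota : {rmorphism R -> S}) : Prop :=
  [/\ injective iota, is_reduced S,
      forall r e, exists x, x ^+ (p ^ e) = iota r
    & forall B : subringClosed S,
        (forall x r e, x ^+ (p ^ e) = iota r -> x \in B) -> forall x, x \in B].

Definition is_domain (R : comNzRingType) : Prop :=
  GRing.integral_domain_axiom R.

Arguments is_perfect_closure p {R S} iota.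

Definition is_fraction_field (R : comNzRingType) (K : fieldType)
    (j : {rmorphism R -> K}) : Prop :=
  injective j /\ forall x, exists a b, j b != 0 /\ x = j a / j b.

(* R^+: K is the fraction field of R, and L an algebraic closure of K *)
Definition is_plus_ring (R T : comNzRingType) (j : {rmorphism R -> T}) : Prop :=
  exists (K : fieldType) (f : {rmorphism R -> K}) (L : closedFieldType)
         (g : {rmorphism K -> L}) (h : {rmorphism T -> L}),
  [/\ is_fraction_field f, forall x, algebraicOver g x,
      injective h, forall r, h (j r) = g (f r)
    & range h = [set x | integralOver (g \o f) x]].

Definition is_grading (R : comNzRingType) (G : nat -> set R) : Prop :=
  [/\ forall d, G d 0 /\ (forall a b, G d a -> G d b -> G d (a - b)),
      forall d e a b, G d a -> G e b -> G (d + e)%N (a * b),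
      forall a, exists n (f : nat -> R),
        (forall d, G d (f d)) /\ a = \sum_(d < n) f d
    & forall n (f : nat -> R), (forall d, G d (f d)) ->
        \sum_(d < n) f d = 0 -> forall d, (d < n)%N -> f d = 0].

Section GradedPlus.
Variables (R T : comNzRingType) (G : nat -> set R) (j : {rmorphism R -> T}).

(* f^t + r_1 f^(t-1) + ... + r_t = 0 with r_i zero or homogeneous of degree
   i * delta *)
Definition homog_integral (delta : rat) (f : T) : Prop :=
  exists (t : nat) (r : nat -> R),
    f ^+ t + \sum_(1 <= i < t.+1) j (r i) * f ^+ (t - i) = 0 /\
    forall i, (1 <= i <= t)%N ->
      r i = 0 \/ exists d : nat, d%:R = i%:R * delta /\ G d (r i).

Definition plusGR_set : set T :=
  [set x | forall B : subringClosed T,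
    (forall delta f, 0 <= delta -> homog_integral delta f -> f \in B) ->
    x \in B].

(* The homogeneous component of R^{+GR} of degree delta: sums of products of
   the generators above whose degrees add up to delta. *)
Inductive plusGR_component : rat -> set T :=
| plusGR_gen delta f :
    0 <= delta -> homog_integral delta f -> plusGR_component delta f
| plusGR_sub delta f g : plusGR_component delta f ->
    plusGR_component delta g -> plusGR_component delta (f - g)
| plusGR_mul delta eps f g : plusGR_component delta f ->
    plusGR_component eps g -> plusGR_component (delta + eps) (f * g).

Definition plusgr_set : set T :=
  finite_sums [set x | exists d : nat, plusGR_component d%:R x].

End GradedPlus.

(* [T] is R^+ *)
Definition is_plusGR_ring (R S : comNzRingType) (G : nat -> set R)
    (iota : {rmorphism R -> S}) : Prop :=
  exists (T : comNzRingType) (j : {rmorphism R -> T}) (h : {rmorphism S -> T}),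
  [/\ is_plus_ring j, injective h, forall r, h (iota r) = j r
    & range h = plusGR_set G j].

Definition is_plusgr_ring (R S : comNzRingType) (G : nat -> set R)
    (iota : {rmorphism R -> S}) : Prop :=
  exists (T : comNzRingType) (j : {rmorphism R -> T}) (h : {rmorphism S -> T}),
  [/\ is_plus_ring j, injective h, forall r, h (iota r) = j r
    & range h = plusgr_set G j].

(* Main.v *)
From HB Require Import structures.
From mathcomp Require Import all_boot all_order all_algebra.
From mathcomp Require Import ring.
From mathcomp Require Import boolp classical_sets.
Require Import Defs.

(* With N_k = N + m^k M, level k of the m-adic closure condition says, by right
   exactness of the tensor product, that u lies in the S-closure of N_k, which
   by hypothesis is the tight closure of N_k over R, as M/N_k is m-coprimary.
   So the claim is that u/1 is in the tight closure of N_m over R_m iff u is in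
   the tight closure of every N_k.
   Elements outside m act bijectively on F^e(M)/N_k^[q], so a relation
   c u^q in N_k^[q] descends from R_m to R; c can be made regular without
   changing its image in R_m. Conversely a test element c/s of R_m gives
   c u^q in N_k^[q] for all k at once, hence c u^q in N^[q] + m^k F^e(M) for all
   k, and Krull's intersection theorem over R yields t c u^q in N^[q] for some t
   outside m. *)

Set Implicit Arguments.
Unset Strict Implicit.
Unset Printing Implicit Defensive.

Import GRing.Theory.
Local Open Scope ring_scope.
Local Open Scope classical_set_scope.

(** A tight closure relation comes with a multiplier and a lower bound on q, and both may vary with
    k. Nothing can be intersected over k at a fixed q until they are uniform, and this is the
    service of the test element. It lives only in R_m, so relations travel from R to R_m and back,
    and return with a stray factor outside m. For the N_k that factor can be cancelled. For N itself
    it has to be kept until R_m is reached again, where it is a unit; this is why Krull's theorem is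
    run over R, on F^e(M), with a factor t in its conclusion. Lying off the minimal primes is
    handled through regularity: the two agree in a reduced Noetherian ring, and R_m inherits what is
    needed for this. In case (i) the Frobenius closure must first be recognised as the closure
    defined by S. Taking q-th roots gives one inclusion; for the other, roots are cleared from a
    derivation of a tensor relation. *)

Definition submodule (A : comNzRingType) (V : lmodType A) (X : set V) : Prop :=
  [/\ X 0, forall x y, X x -> X y -> X (x + y)
    & forall a x, X x -> X (a *: x)].

Definition ideal (A : comNzRingType) (I : set A) : Prop :=
  @submodule A A^o I.

Definition lspan (A : comNzRingType) (V : lmodType A) (s : seq V) : set V :=
  [set v | exists c : nat -> A, v = \sum_(i < size s) c i *: s`_i].

(** * Submodules as sets, and finite spans *)

Section Submodules.
Variables (A : comNzRingType) (V : lmodType A).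
Implicit Types (X Y : set V) (s t : seq V).

Lemma submoduleN X x : submodule X -> X x -> X (- x).
Proof. by case=> _ _ XZ Xx; rewrite -scaleN1r; apply: XZ. Qed.

Lemma submoduleB X x y : submodule X -> X x -> X y -> X (x - y).
Proof.
by move=> sX Xx Xy; case: (sX) => _ XD _; apply: XD => //; apply: submoduleN.
Qed.

Lemma submodule_sum (I : Type) (r : seq I) (P : pred I) (F : I -> V) X :
  submodule X -> (forall i, P i -> X (F i)) -> X (\sum_(i <- r | P i) F i).
Proof. by case=> X0 XD _ XF; elim/big_ind: _. Qed.

(** Bridge from sets, convenient for unions of chains, colon ideals and preimages, to the bundled
    submodules that have quotients and tensor images. *)
Lemma submodule_submodClosed X : submodule X ->
  exists N : submodClosed V, forall x, (x \in N) <-> X x.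
Proof.
case=> X0 XD XZ; pose S : {pred V} := fun x => `[<X x>].
have SP x : reflect (X x) (x \in S) by exact: asboolP.
have cl : GRing.subsemimod_closed S.
  split; first split; first exact/SP.
  - by move=> x y /SP ? /SP ?; apply/SP/XD.
  - by move=> a x /SP ?; apply/SP/XZ.
pose N : submodClosed V :=
  HB.pack S (GRing.isSubSemiModClosed.Build A V S cl).
by exists N => x; split=> [/SP|?]; last exact/SP.
Qed.

Lemma lspan_submodule s : submodule (lspan s).
Proof.
split=> [|_ _ [c ->] [d ->]|a _ [c ->]].
- by exists (fun=> 0); rewrite big1 // => i _; rewrite scale0r.
- exists (fun i => c i + d i); rewrite -big_split.
  by apply: eq_bigr => i _; rewrite scalerDl.
- exists (fun i => a * c i); rewrite scaler_sumr.
  by apply: eq_bigr => i _; rewrite scalerA.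
Qed.

Lemma mem_lspan s x : x \in s -> lspan s x.
Proof.
move=> xs; exists (fun i => (i == index x s)%:R).
have ltxs : (index x s < size s)%N by rewrite index_mem.
rewrite (bigD1 (Ordinal ltxs)) //= eqxx scale1r nth_index // big1 ?addr0 // => i.
by rewrite -val_eqE /= => /negPf ->; rewrite scale0r.
Qed.

Lemma lspan_sub s X : submodule X -> (forall x, x \in s -> X x) -> lspan s `<=` X.
Proof.
move=> sX sX' _ [c ->]; apply: submodule_sum => // i _.
by case: sX => _ _; apply; apply/sX'/mem_nth.
Qed.

Lemma fingen_submodP (N : submodClosed V) : fingen (submod N) <->
  exists s, (forall x, x \in s -> x \in N) /\ (forall x, x \in N -> lspan s x).
Proof.
split=> [[s gs]|[s [sN gs]]].
  exists (map val s); split=> [_ /mapP[y _ ->]|x Nx]; first exact: valP.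
  have [c e] := gs (Sub x Nx); exists c; rewrite size_map.
  transitivity (incl N (Sub x Nx)) => //; rewrite e raddf_sum.
  by apply: eq_bigr => i _; rewrite (nth_map 0) // [LHS]linearZ.
(* A section of [val], with default value 0 outside N, carries the generators back to the
   subtype. *)
have /choice[f fP] : forall x : V, exists y : submod N, x \in N -> val y = x.
  move=> x; have [Nx|Nx] := boolP (x \in N); last by exists 0.
  by exists (Sub x Nx).
exists (map f s) => -[v Nv]; have [c e] := gs v Nv.
exists c; apply: val_inj; rewrite [LHS]e raddf_sum size_map.
apply: eq_bigr => i _; rewrite (nth_map 0) // [RHS]linearZ /=; congr (_ *: _).
by rewrite fP //; apply/sN/mem_nth.
Qed.

End Submodules.

(** * Powers of ideals *)

Section IdealPower.
Variable A : comNzRingType.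

Lemma finite_sums_min (V : nmodType) (X Y : set V) :
  Y 0 -> (forall x y, Y x -> Y y -> Y (x + y)) -> X `<=` Y ->
  finite_sums X `<=` Y.
Proof.
move=> Y0 YD XY _ [s [sX ->]]; rewrite big_seq.
by elim/big_ind: _ => // x xs; apply/XY/sX.
Qed.

Lemma finite_sums0 (V : nmodType) (X : set V) : finite_sums X 0.
Proof. by exists [::]; rewrite big_nil. Qed.

Lemma finite_sumsD (V : nmodType) (X : set V) x y :
  finite_sums X x -> finite_sums X y -> finite_sums X (x + y).
Proof.
move=> [s [sX ->]] [t [tX ->]]; exists (s ++ t); rewrite big_cat; split=> //.
by move=> z; rewrite mem_cat => /orP[/sX|/tX].
Qed.

Lemma mem_finite_sums (V : nmodType) (X : set V) : X `<=` finite_sums X.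
Proof.
move=> x Xx; exists [:: x]; rewrite big_seq1; split=> // y.
by rewrite inE => /eqP ->.
Qed.

Lemma finite_sums_submodule (V : lmodType A) (X : set V) :
  (forall a x, X x -> X (a *: x)) -> submodule (finite_sums X).
Proof.
move=> XZ; split; [exact: finite_sums0 | exact: finite_sumsD |].
move=> a _ [s [sX ->]]; exists [seq a *: x | x <- s].
rewrite big_map scaler_sumr; split=> // _ /mapP[x /sX Xx ->].
exact: XZ.
Qed.

Lemma ideal_power_ideal (I : set A) k : ideal I -> ideal (ideal_power I k).
Proof.
case: k => [|k] iI; first by split.
apply: (@finite_sums_submodule A^o) => a _ [b Ib [c Ic <-]].
exists (a * b); first by case: iI => _ _; apply.
by exists c => //; rewrite [RHS]mulrA.
Qed.

Lemma ideal_powerM (I : set A) k a b :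
  I a -> ideal_power I k b -> ideal_power I k.+1 (a * b).
Proof. by move=> Ia Ib; apply: mem_finite_sums; exists a => //; exists b. Qed.

Lemma ideal_power_exp (I : set A) k a : I a -> ideal_power I k (a ^+ k).
Proof. by move=> Ia; elim: k => //= k ih; rewrite exprS; apply: ideal_powerM. Qed.

Lemma ideal_power_min (I J : set A) k : ideal J ->
  (forall a b, I a -> ideal_power I k b -> J (a * b)) ->
  ideal_power I k.+1 `<=` J.
Proof.
move=> [J0 JD _] IJ; apply: finite_sums_min => // _ [a Ia [b Ib <-]].
exact: IJ.
Qed.

Lemma ideal_power_le (I : set A) k l : ideal I -> (k <= l)%N ->
  ideal_power I l `<=` ideal_power I k.
Proof.
move=> iI; elim: l => [|l ih]; first by rewrite leqn0 => /eqP ->.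
rewrite leq_eqVlt => /predU1P[-> //|/ih lek] a; apply: subset_trans lek a.
apply: ideal_power_min => [|a b Ia Ib]; first exact: ideal_power_ideal.
by case: (ideal_power_ideal l iI) => _ _; apply.
Qed.

(** The identity I^(k+l) = I^k I^l, phrased as minimality so that no product of ideals has to be
    defined. *)
Lemma ideal_powerD_min (I J : set A) k l : ideal J ->
  (forall a b, ideal_power I k a -> ideal_power I l b -> J (a * b)) ->
  ideal_power I (k + l) `<=` J.
Proof.
move=> iJ; have [J0 JD JZ] := iJ.
elim: k J iJ J0 JD JZ => [|k ih] J iJ J0 JD JZ IJ.
  by move=> b Ib; rewrite -[b]mul1r; apply: IJ.
rewrite addSn; apply: ideal_power_min => // a b Ia Ib.
(* The induction hypothesis is applied to the colon ideal (J : a) in place of J. *)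
have /(_ b Ib)// : ideal_power I (k + l) `<=` [set b | J (a * b)].
have Ja0 : J (a * 0) by rewrite mulr0.
have JaD x y : J (a * x) -> J (a * y) -> J (a * (x + y)).
  by rewrite mulrDr; apply: JD.
have JaZ c x : J (a * x) -> J (a * (c * x)).
  by rewrite mulrCA; apply: JZ.
apply: ih => // x y Ix Iy /=; rewrite mulrA; apply: IJ => //.
exact: ideal_powerM.
Qed.

End IdealPower.

(** * The maximal condition on ideals *)

Section Noetherian.
Variable A : comNzRingType.

(** This form of the Noetherian property yields maximal annihilators and stable colon ideals
    directly, and passes to R_m by mere contraction of ideals. *)
Definition max_condition : Prop := forall F : set (set A),
  F `<=` ideal (A:=A) -> F !=set0 ->
  exists2 I, F I & forall J, F J -> I `<=` J -> J `<=` I.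

Lemma noetherian_max_condition : is_noetherian A -> max_condition.
Proof.
move=> noeth F Fid [I0 FI0].
have [C CP Ctot|I [PI Imax]] := @Zorn_bigcup A (fun X => X = set0 \/ F X).
  have [[X CX FX]|none] := pselect (exists2 X, C X & F X); last first.
    left; rewrite -subset0 => x [X CX Xx]; case: (CP _ CX) => [X0|FX].
      by rewrite X0 in Xx.
    by case: none; exists X.
  right; set U := \bigcup_(X in C) X.
  have idC Y x : C Y -> Y x -> ideal Y.
    by move=> CY Yx; case: (CP _ CY) => [Y0|/Fid//]; rewrite Y0 in Yx.
  have iU : ideal U.
    have [X0 _ _] := Fid _ FX; split; first by exists X.
      move=> x y [Y CY Yx] [Z CZ Zy].
      case: (Ctot _ _ CY CZ) => [/(_ _ Yx) Zx|/(_ _ Zy) Yy].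
        by exists Z => //; case: (idC _ _ CZ Zx) => _ + _; apply.
      by exists Y => //; case: (idC _ _ CY Yx) => _ + _; apply.
    by move=> a x [Y CY Yx]; exists Y => //; case: (idC _ _ CY Yx) => _ _; apply.
  have [N NU] := submodule_submodClosed iU.
  have /fingen_submodP[s [sN gs]] := noeth N.
  have [Y [CY FY sY]] : exists Y, [/\ C Y, F Y & forall x, x \in s -> Y x].
    have {sN gs}: forall x, x \in s -> U x by move=> x /sN /NU.
    elim: s => [_|x s ih sU]; first by exists X; split.
    have [y ys|Y [CY FY sY]] := ih; first by apply: sU; rewrite inE ys orbT.
    have [Z CZ Zx] : U x by apply: sU; rewrite mem_head.
    case: (Ctot _ _ CY CZ) => [YZ|ZY].
      exists Z; split=> //; first by case: (CP _ CZ) => // Z0; rewrite Z0 in Zx.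
      by move=> y; rewrite inE => /predU1P[-> //|/sY /YZ].
    by exists Y; split=> // y; rewrite inE => /predU1P[->|/sY //]; apply: ZY.
  suff -> : U = Y by [].
  apply/seteqP; split=> [x /NU /gs|x Yx]; last by exists Y.
  by apply: lspan_sub => //; apply: Fid.
have FI : F I.
  case: PI => // I0'; case: (Imax I0); last by right.
  rewrite I0'; split; first exact: sub0set.
  by move=> /(_ 0); apply; case: (Fid _ FI0).
exists I => // J FJ IJ; apply: contrapT => nJI.
by apply: (Imax J); [split | right].
Qed.

Hypothesis maxA : max_condition.

(* In a maximal counterexample J, take b = a^n outside J with a b in J: the
   powers of I eventually lie in both J + (b) and (J : b). *)
Lemma radical_power (I J : set A) : ideal I -> ideal J ->
  (forall a, I a -> exists n, J (a ^+ n)) -> exists k, ideal_power I k `<=` J.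
Proof.
move=> iI iJ rad; apply: contrapT => nopow.
have [||K [iK radK nK] Kmax] := maxA (F := [set K | [/\ ideal K,
    forall a, I a -> exists n, K (a ^+ n)
  & ~ exists k, ideal_power I k `<=` K]]).
- by move=> K [].
- exists J; split=> //.
have [K0 KD KZ] := iK.
have KZ' a b : K b -> K (a * b) := KZ a b.
have [IK|/existsNP[a /not_implyP[Ia nKa]]] := pselect (I `<=` K).
  apply: nK; exists 1%N; apply: ideal_power_min => // a b Ia _.
  by rewrite mulrC; apply/KZ'/IK.
have /ex_minnP[n Kn nmin] : exists n, `[< K (a ^+ n) >].
  by have [n Kn] := radK a Ia; exists n; apply/asboolP.
case: n Kn nmin => [/asboolP K1 _|n /asboolP Kn nmin].
  by apply: nK; exists 0%N => b _; rewrite -[b]mulr1; apply: KZ'.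
set b := a ^+ n; have nKb : ~ K b.
  by move=> /asboolP /nmin; rewrite ltnn.
pose L1 : set A := [set x | exists2 y, K y & exists r, x = y + r * b].
pose L2 : set A := [set r | K (r * b)].
have iL1 : ideal L1.
  split; first by exists 0 => //; exists 0; rewrite mul0r addr0.
    move=> _ _ [x Kx [r ->]] [y Ky [t ->]]; exists (x + y); first exact: KD.
    by exists (r + t); rewrite mulrDl addrACA.
  move=> c _ [x Kx [r ->]]; exists (c * x); first exact: KZ'.
  by exists (c * r); rewrite [LHS]mulrDr mulrA.
have iL2 : ideal L2.
  split; rewrite /L2 /=; first by rewrite mul0r.
    by move=> x y; rewrite mulrDl; apply: KD.
  by move=> c x Kx; rewrite -mulrA; apply: KZ'.
have KL1 : K `<=` L1 by move=> x Kx; exists x => //; exists 0; rewrite mul0r addr0.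
have KL2 : K `<=` L2 by move=> x Kx; rewrite /L2 /= mulrC; apply: KZ'.
have powL L : ideal L -> K `<=` L -> ~ L `<=` K ->
    exists k, ideal_power I k `<=` L.
  move=> iL KL nLK; apply: contrapT => nL; apply/nLK/Kmax => //; split=> //.
  by move=> c Ic; have [l Kl] := radK c Ic; exists l; apply: KL.
have [|k1 k1P] := powL L1 iL1 KL1.
  by apply/existsNP; exists b => h; apply/nKb/h; exists 0 => //; exists 1;
     rewrite mul1r add0r.
have [|k2 k2P] := powL L2 iL2 KL2.
  by apply/existsNP; exists a => h; apply/nKa/h; rewrite /L2 /= -exprS.
(* [L1] is K + (b) and [L2] is (K : b), so the product of their elements lies in K. *)
apply: nK; exists (k2 + k1)%N; apply: ideal_powerD_min => // u v /k2P Ku /k1P.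
move=> [y Ky [r ->]]; rewrite mulrDr; apply: KD; first exact: KZ'.
by rewrite mulrCA; apply: KZ'.
Qed.

End Noetherian.

(** Zorn's lemma for modules, because it serves twice: for ideals missing a multiplicative set, and
    for submodules missing the multiples s x in Krull's theorem. *)
Lemma maximal_avoiding (A : comNzRingType) (V : lmodType A) (B D : set V) :
  submodule B -> (forall x, B x -> ~ D x) ->
  exists C, [/\ submodule C, B `<=` C, forall x, C x -> ~ D x &
    forall C', submodule C' -> C `<=` C' -> (forall x, C' x -> ~ D x) ->
      C' `<=` C].
Proof.
move=> sB BD; pose good C := [/\ submodule C, B `<=` C & forall x, C x -> ~ D x].
have [F FP Ftot|C [PC Cmax]] := @Zorn_bigcup V (fun X => X = set0 \/ good X).
  have [[X FX gX]|none] := pselect (exists2 X, F X & good X); last first.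
    left; rewrite -subset0 => x [X FX Xx]; case: (FP _ FX) => [X0|gX].
      by rewrite X0 in Xx.
    by case: none; exists X.
  have gF Y x : F Y -> Y x -> good Y.
    by move=> FY Yx; case: (FP _ FY) => [Y0|//]; rewrite Y0 in Yx.
  have [[X0 _ _] BX _] := gX.
  right; split; [split| |].
  - by exists X.
  - move=> x y [Y FY Yx] [Z FZ Zy].
    case: (Ftot _ _ FY FZ) => [/(_ _ Yx) Zx|/(_ _ Zy) Yy].
      by exists Z => //; case: (gF _ _ FZ Zx) => -[_ + _] _ _; apply.
    by exists Y => //; case: (gF _ _ FY Yx) => -[_ + _] _ _; apply.
  - by move=> a x [Y FY Yx]; exists Y => //;
    case: (gF _ _ FY Yx) => -[_ _ +] _ _; apply.
  - by move=> x /BX Xx; exists X.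
  - by move=> x [Y FY Yx]; case: (gF _ _ FY Yx) => _ _; apply.
have [sC BC CD] : good C.
  case: PC => // C0; case: (Cmax B); last by right; split.
  by rewrite C0; split; [exact: sub0set | move=> /(_ 0); apply; case: sB].
exists C; split=> // C' sC' CC' C'D; apply: contrapT => nC'C.
by apply: (Cmax C'); [split | right; split=> // x /BC /CC'].
Qed.

Lemma submodule_adjoin (A : comNzRingType) (V : lmodType A) (C : set V) v :
  submodule C -> submodule [set x | exists2 c, C c & exists r, x = c + r *: v].
Proof.
case=> C0 CD CZ; split; first by exists 0 => //; exists 0; rewrite scale0r addr0.
- move=> _ _ [x Cx [r ->]] [y Cy [t ->]]; exists (x + y); first exact: CD.
  by exists (r + t); rewrite scalerDl addrACA.
- move=> a _ [x Cx [r ->]]; exists (a *: x); first exact: CZ.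
  by exists (a * r); rewrite scalerDr scalerA.
Qed.

Lemma maximal_avoiding_adjoin (A : comNzRingType) (V : lmodType A)
    (C D : set V) v :
  submodule C ->
  (forall C', submodule C' -> C `<=` C' -> (forall x, C' x -> ~ D x) ->
     C' `<=` C) ->
  ~ C v -> exists c r, C c /\ D (c + r *: v).
Proof.
move=> sC Cmax nCv; apply: contrapT => nex; apply/nCv/Cmax.
- exact: (submodule_adjoin v sC).
- by move=> x Cx; exists x => //; exists 0; rewrite scale0r addr0.
- by move=> _ [c Cc [r ->]] Dx; apply: nex; exists c, r.
- by exists 0; [case: sC | exists 1; rewrite scale1r add0r].
Qed.

(** * Minimal primes and regular elements *)

Section Primes.
Variable A : comNzRingType.

Lemma prime_idealr_ideal (P : prime_idealr A) : ideal [set` P].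
Proof.
by split=> [|a b|a b]; rewrite /= ?rpred0 //; [exact: rpredD | exact: idealMr].
Qed.

Lemma prime_of_set (P : set A) : ideal P -> ~ P 1 ->
  (forall a b, P (a * b) -> P a \/ P b) ->
  exists Q : prime_idealr A, forall x, (x \in Q) <-> P x.
Proof.
case=> P0 PD PZ nP1 Pprime; pose S : A -> bool := fun x => `[<P x>].
have SP x : reflect (P x) (x \in (S : {pred A})) by exact: asboolP.
have cl : idealr_closed (S : {pred A}).
  split; [exact/SP | exact/SP |] => a x y /SP Px /SP Py; apply/SP/PD => //.
  exact: PZ.
have pr : prime_idealr_closed (S : {pred A}).
  by move=> x y /SP /Pprime[] ?; apply/orP; [left|right]; apply/SP.
pose Q : prime_idealr A :=
  HB.pack S (isIdealr.Build A S cl) (isPrimeIdealrClosed.Build A S pr).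
by exists Q => x; split=> [/SP|?]; last exact/SP.
Qed.

(** An ideal I maximal among those missing T is prime: if a and b are outside I, then I + (a) and I
    + (b) meet T, and the product of two such elements is in T and in I + (a b). *)
Lemma prime_avoiding (T : set A) : T 1 -> (forall a b, T a -> T b -> T (a * b)) ->
  ~ T 0 -> exists Q : prime_idealr A, forall x, T x -> x \notin Q.
Proof.
move=> T1 TM nT0.
have [||I [iI _ IT Imax]] := @maximal_avoiding A A^o [set 0] T.
- by split=> [|x y -> ->|a x ->]; rewrite /= ?addr0 ?scaler0.
- by move=> x ->.
have [I0 ID IZ] := iI.
have ID' (a b : A) : I a -> I b -> I (a + b) := ID a b.
have IZ' a b : I b -> I (a * b) := IZ a b.
have [||a b Iab|Q QI] := @prime_of_set I.
- by [].
- by move=> /IT.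
- have [Ia|nIa] := pselect (I a); first by left.
  have [Ib|nIb] := pselect (I b); first by right.
  have [i [r [Ii Ti]]] := maximal_avoiding_adjoin iI Imax nIa.
  have [j [t [Ij Tj]]] := maximal_avoiding_adjoin iI Imax nIb.
  case: (IT _ _ (TM _ _ Ti Tj)); rewrite mulrDl; apply: (ID' _ _).
    by rewrite mulrC; apply: IZ'.
  rewrite mulrDr; apply: ID'; first exact: IZ'.
  have -> : r *: (a : A^o) * (t *: (b : A^o)) = (r * t) * (a * b).
    rewrite /GRing.scale /=; ring.
  exact: IZ'.
by exists Q => x Tx; apply/negP => /QI /IT.
Qed.

(** If c were in P, the products c^n x with x outside P would form a multiplicative set without 0. A
    prime missing it lies inside P and omits c, against minimality. *)
Lemma regular_off_minimal_primes (c : A) :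
  (forall x, c * x = 0 -> x = 0) -> off_minimal_primes c.
Proof.
move=> regc P Pmin; apply/negP => Pc.
have regcn n x : c ^+ n * x = 0 -> x = 0.
  by elim: n x => [|n ih] x; rewrite ?mul1r // exprSr -mulrA => /ih /regc.
have [|a b [x [nx [n ->]]] [y [ny [k ->]]]|[x [nx [n]]]|Q QT] :=
  @prime_avoiding [set a | exists x, x \notin P /\ exists n, a = c ^+ n * x].
- by exists 1; rewrite idealr1; split=> //; exists 0%N; rewrite mulr1.
- exists (x * y); rewrite prime_idealrM negb_or nx ny; split=> //.
  by exists (n + k)%N; rewrite exprD; ring.
- by move=> /esym /regcn x0; rewrite x0 rpred0 in nx.
have QP : {subset Q <= P}.
  move=> a Qa; apply: contraT => nPa.
  suff : a \notin Q by rewrite Qa.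
  by apply: QT; exists a; split=> //; exists 0%N; rewrite mul1r.
suff : c \notin Q by rewrite (Pmin Q QP).
by apply: QT; exists 1; rewrite idealr1; split=> //; exists 1%N; rewrite mulr1.
Qed.

Hypotheses (maxA : max_condition A) (redA : is_reduced A).

(* The annihilators of the nonzero y with c y = 0 contain c, and a maximal one
   is a minimal prime since the ring is reduced. *)
Lemma off_minimal_primes_regular (c : A) :
  off_minimal_primes c -> forall x, c * x = 0 -> x = 0.
Proof.
move=> offc x cx0; apply: contrapT => x0.
pose ann (y : A) : set A := [set a | a * y = 0].
have iann y : ideal (ann y).
  split; rewrite /ann /=; first by rewrite mul0r.
    by move=> a b aP bP; rewrite mulrDl aP bP addr0.
  by move=> a b bP; rewrite -[_ *: _]/(a * b) -mulrA bP mulr0.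
have [_ [y _ <-]||_ [y [y0 cy] <-] ymax] :=
  maxA (F := ann @` [set y | y <> 0 /\ c * y = 0]).
- exact: iann.
- by exists (ann x); exists x.
have [|||P PP] := @prime_of_set (ann y).
- exact: iann.
- by rewrite /ann /= mul1r.
- move=> a b; rewrite /ann /= => ab; have [?|by0] := pselect (b * y = 0).
    by right.
  left; apply: (ymax (ann (b * y))).
  + by exists (b * y); split=> //; rewrite mulrCA cy mulr0.
  + by move=> z; rewrite /ann /= mulrCA => ->; rewrite mulr0.
  + by rewrite /ann /= mulrA.
suff : c \notin P by move/negP; apply; apply/PP.
apply: offc.
(* Since a y = 0 is in Q, either a or y is in Q; in the latter case y is in P = ann y, so y^2 =
   0. *)
move=> Q QP a /PP aP.
have : a * y \in Q by rewrite aP rpred0.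
rewrite prime_idealrM => /orP[//|/QP /PP yy]; case: y0.
by apply: (@redA _ 2%N).
Qed.

(* Enlarging [d] within the annihilator of [c] shrinks the annihilator of [d];
   a [d] for which it can shrink no more works. *)
Lemma regular_completion (c : A) :
  exists2 d, c * d = 0 & forall x, (c + d) * x = 0 -> x = 0.
Proof.
have sq (a : A) : a * a = 0 -> a = 0.
  by move=> aa; apply: (@redA _ 2%N).
(* [bi d] is the double annihilator of d. It grows as the annihilator of d shrinks, which makes the
   maximal condition applicable. *)
pose bi (d : A) : set A := [set x | forall y, y * d = 0 -> x * y = 0].
have ibi d : ideal (bi d).
  split; rewrite /bi /=; first by move=> y _; rewrite mul0r.
    by move=> a b aP bP y yd; rewrite mulrDl aP ?bP ?addr0.
  by move=> a b bP y yd; rewrite -[_ *: _]/(a * b) -mulrA bP ?mulr0.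
have [_ [d _ <-]||_ [d cd <-] dmax] := maxA (F := bi @` [set d | c * d = 0]).
- exact: ibi.
- by exists (bi 0); exists 0 => //=; rewrite mulr0.
exists d => // e cde.
have ce : c * e = 0.
  apply: sq.
  rewrite (_ : _ * _ = ((c + d) * e) * (c * e) - (c * d) * e * e); last by ring.
  by rewrite cde cd; ring.
have de : d * e = 0 by rewrite -[LHS]add0r -[X in X + _]ce -mulrDl.
have annde y : y * (d + e) = 0 -> y * d = 0.
  move=> yde; have yd2 : (y * d) * (y * d) = 0.
    rewrite (_ : _ * _ = (y * (d + e)) * (y * d) - y * y * (d * e)); last by ring.
    by rewrite yde de; ring.
  exact: sq.
(* The annihilator of d + e lies in that of d, so maximality applies. As e kills d, it then kills d
   + e as well, whence e^2 = 0. *)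
have : bi d (d + e).
  apply: (dmax (bi (d + e))).
  - by exists (d + e) => //=; rewrite mulrDr cd ce addr0.
  - by move=> x xP y /annde /xP.
  - by move=> y; rewrite mulrC.
move=> /(_ e); rewrite [e * d]mulrC de => /(_ erefl).
by rewrite mulrDl de add0r => /sq.
Qed.

End Primes.

(* A submodule C containing B and maximal among those missing every s x, s not
   in m, contains m x. If a^n w were never in C, each C + R a^n w would contain
   some s x, contradicting the stabilisation of the ideals (C : a^n w). So a
   power of m maps W, hence x, into C. *)
Lemma krull_intersection (R : comNzRingType) (m : prime_idealr R)
    (W : lmodType R) (B : set W) (x : W) :
  max_condition R -> fingen W -> submodule B ->
  (forall k, exists2 b, B b & mulset (ideal_power [set` m] k) W (x - b)) ->
  exists2 s, s \notin m & B (s *: x).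
Proof.
move=> maxR [g gP] sB xB; apply: contrapT => nsx.
have [||C [sC BC CD Cmax]] := @maximal_avoiding R W B
  [set y | exists2 s, s \notin m & y = s *: x].
- by [].
- by move=> y By [s sm e]; apply: nsx; exists s; rewrite -?e.
have [C0 CDD CZ] := sC.
have CDx s : s \notin m -> ~ C (s *: x) by move=> sm /CD; apply; exists s.
have adj v : ~ C v -> exists s r, s \notin m /\ C (s *: x - r *: v).
  move=> /(maximal_avoiding_adjoin sC Cmax)[c [r [Cc [s sm e]]]].
  by exists s, r; split=> //; rewrite -e addrK.
have Cmx a : a \in m -> C (a *: x).
  move=> am; apply: contrapT => /adj[s [r [sm]]].
  rewrite scalerA -scalerBl; apply: CDx; apply: contra sm => smra.
  by rewrite -[s](subrK (r * a)) rpredD // idealMr.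
have im := prime_idealr_ideal m.
pose J w : set R := [set r | C (r *: w)].
have iJ w : ideal (J w).
  split; rewrite /J /=; first by rewrite scale0r.
    by move=> a b; rewrite scalerDl; apply: CDD.
  by move=> a b; rewrite -[_ *: b]/(a * b) -scalerA; apply: CZ.
have pow w a : a \in m -> exists n, C (a ^+ n *: w).
  move=> am; apply: contrapT => nC.
  have [_ [n _ <-]||_ [n _ <-] nmax] :=
    maxR ((fun n => J (a ^+ n *: w)) @` [set: nat]).
  - exact: iJ.
  - by exists (J (a ^+ 0 *: w)); exists 0%N.
  (* Multiplying s x - r a^n w by a gives r a^(n+1) w in C, because a x is in C. By stabilisation r
     a^n w is in C, and then so is s x. *)
  have [|s [r [sm Cs]]] := adj (a ^+ n *: w).
    by move=> Cn; apply: nC; exists n.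
  apply: (CDx s sm); rewrite -[_ *: _](subrK (r *: (a ^+ n *: w))).
  apply: CDD => //; apply: (nmax (J (a ^+ n.+1 *: w))).
  - by exists n.+1.
  - move=> t; rewrite /J /= exprS -[a * _ *: _]scalerA => /(CZ a).
    by rewrite scalerA mulrC -scalerA.
  rewrite /J /= exprS -[a * _ *: _]scalerA.
  have sax : a *: (s *: x) = s *: (a *: x) by rewrite !scalerA mulrC.
  have raw : a *: (r *: (a ^+ n *: w)) = r *: (a *: (a ^+ n *: w)).
    by rewrite !scalerA; congr (_ *: _); ring.
  have /(CZ a) := Cs; rewrite scalerBr sax raw => Ca.
  have := submoduleB sC (CZ s _ (Cmx a am)) Ca.
  by rewrite opprB addrC subrK.
have [k kP] : exists k, forall w, w \in g -> ideal_power [set` m] k `<=` J w.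
  elim: g {gP} => [|w g [k kP]]; first by exists 0%N.
  have [l lP] := radical_power maxR im (iJ w) (pow w).
  exists (k + l)%N => v; rewrite inE => /predU1P[->|/kP].
    by apply: subset_trans lP; apply: ideal_power_le (leq_addl _ _).
  by apply: subset_trans; apply: ideal_power_le (leq_addr _ _).
have [b Bb] := xB k.
have : mulset (ideal_power [set` m] k) W `<=` C.
  apply: finite_sums_min => // _ [a ak [w _ <-]].
  have [c ->] := gP w; rewrite scaler_sumr; apply: submodule_sum => // i _.
  by rewrite scalerA mulrC -scalerA; apply/CZ/(kP g`_i)/ak/mem_nth.
move=> mC /mC Cxb; apply: (CDx 1); first by rewrite idealr1.
by rewrite scale1r -[x](subrK b); apply/CDD/BC.
Qed.

Section QuotientMap.
Variables (R : comNzRingType) (V : lmodType R) (N : submodClosed V).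

Fact quot_pi_linear : linear (quot_pi N).
Proof. by move=> a x y; rewrite quot_scaleE quot_addE. Qed.
HB.instance Definition _ :=
  GRing.isLinear.Build R V (quotmod N) _ (quot_pi N) quot_pi_linear.
Definition quot_map : {linear V -> quotmod N} := quot_pi N.

Lemma quot_mapP x y : quot_map x = quot_map y <-> x - y \in N.
Proof. exact: quot_piP. Qed.

Lemma quot_mapK z : quot_map (repr z) = z.
Proof. exact: quot_piK. Qed.

Lemma quot_mapD x y : quot_map (x + y) = quot_map x + quot_map y.
Proof. exact: raddfD. Qed.

Lemma quot_mapZ a x : quot_map (a *: x) = a *: quot_map x.
Proof. exact: linearZ. Qed.

Lemma quot_map_eq0 x : quot_map x = 0 <-> x \in N.
Proof. by rewrite -[X in _ <-> X \in _]subr0 -quot_mapP raddf0. Qed.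

End QuotientMap.

(** * Tensor products: universal property and right exactness *)

Section Tensor.
Variables (R S : comNzRingType) (phi : {rmorphism R -> S}) (M : lmodType R).
Local Notation T := (tensor phi M).

Lemma tensDl s t x : tens phi (s + t) x = tens phi s x + tens phi t x :> T.
Proof. by rewrite tens_addE; apply/tens_piP/tens_Dl. Qed.

Lemma tensDr s x y : tens phi s (x + y) = tens phi s x + tens phi s y :> T.
Proof. by rewrite tens_addE; apply/tens_piP/tens_Dr. Qed.

Lemma tensZr s r x : tens phi s (r *: x) = tens phi (s * phi r) x :> T.
Proof. by apply/tens_piP/tens_sym/tens_bal. Qed.

Lemma tens0r s : tens phi s 0 = 0 :> T.
Proof. by apply: (addrI (tens phi s 0)); rewrite -tensDr !addr0. Qed.

Lemma tensZl c s x : c *: tens phi s x = tens phi (c * s) x :> T.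
Proof. by rewrite tens_scaleE. Qed.

Lemma tensNr s x : tens phi s (- x) = - tens phi s x :> T.
Proof. by apply: (addrI (tens phi s x)); rewrite -tensDr !subrr tens0r. Qed.

Lemma tens_elim (P : T -> Prop) :
  P 0 -> (forall z w, P z -> P w -> P (z + w)) ->
  (forall s x, P (tens phi s x)) -> forall z, P z.
Proof.
move=> P0 PD Pt; elim/tens_ind; elim=> [|[s x] a ih]; first exact: P0.
by rewrite -cat1s -tens_addE; apply: PD ih; apply: Pt.
Qed.

(** The target is only an abelian group because the maps built from it change the base ring, by
    localization or by q-th roots. *)
Lemma tens_lift (V : zmodType) (b : S -> M -> V) :
  (forall s t x, b (s + t) x = b s x + b t x) ->
  (forall s x y, b s (x + y) = b s x + b s y) ->
  (forall s r x, b (s * phi r) x = b s (r *: x)) ->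
  exists f : {additive T -> V}, forall s x, f (tens phi s x) = b s x.
Proof.
move=> bDl bDr bZ; pose ev (a : seq (S * M)) : V := \sum_(u <- a) b u.1 u.2.
have ev_rel a a' : tens_rel phi a a' -> ev a = ev a'.
  elim=> {a a'} //= [a c d _ -> _ -> //|a a' c c' _ + _ +|a c|x|s t x|s x y|s r x].
  - by rewrite /ev !big_cat /= => -> ->.
  - by rewrite /ev !big_cat /= addrC.
  - rewrite /ev big_seq1 big_nil /=.
    by apply: (addrI (b 0 x)); rewrite -bDl !addr0.
  - by rewrite /ev big_seq1 big_cons big_seq1 bDl.
  - by rewrite /ev big_seq1 big_cons big_seq1 bDr.
  - by rewrite /ev !big_seq1 bZ.
pose f (z : T) := ev (repr z).
have fpi a : f (tens_pi phi a) = ev a by apply/ev_rel/tens_repr.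
have fD : nmod_morphism f.
  split=> [|z w]; first by rewrite -[0]/(tens_pi phi [::]) fpi /ev big_nil.
  elim/tens_ind: z => a; elim/tens_ind: w => c.
  by rewrite tens_addE !fpi /ev big_cat.
pose F : {additive T -> V} :=
  HB.pack f (GRing.isNmodMorphism.Build T V f fD).
by exists F => s x; rewrite [LHS]fpi /ev big_seq1.
Qed.

Lemma fingen_tensor : fingen M -> fingen T.
Proof.
move=> [g gP]; exists [seq tens phi 1 x | x <- g].
suff h z : lspan [seq tens phi 1 x | x <- g] z by exact: h.
have [s0 sD sZ] := lspan_submodule [seq tens phi 1 x | x <- g].
elim/tens_elim: z => // s x; have [c ->] := gP x.
elim/big_ind: _ => [|y w Py Pw|i _]; first by rewrite tens0r.
  by rewrite tensDr; apply: sD.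
rewrite tensZr -[s * _]mulr1 -tensZl; apply/sZ/mem_lspan/map_f.
exact: mem_nth.
Qed.

End Tensor.

Section TensorMap.
Variables (R S : comNzRingType) (phi : {rmorphism R -> S}).
Variables (M M' : lmodType R) (f : {linear M -> M'}).

Lemma tens_mapD z w : tens_map phi f (z + w) = tens_map phi f z + tens_map phi f w.
Proof. exact: raddfD. Qed.

Lemma tens_mapB z w : tens_map phi f (z - w) = tens_map phi f z - tens_map phi f w.
Proof. exact: raddfB. Qed.

Lemma tens_mapZ c z : tens_map phi f (c *: z) = c *: tens_map phi f z.
Proof. exact: linearZ. Qed.

End TensorMap.

Section Image.
Variables (R S : comNzRingType) (phi : {rmorphism R -> S}) (M : lmodType R).
Variable N : submodClosed M.
Local Notation T := (tensor phi M).

Lemma mem_tens_image s x : x \in N -> tens_image phi N (tens phi s x).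
Proof.
move=> Nx; exists (tens phi s (Sub x Nx : submod N)) => //.
by rewrite tens_mapE.
Qed.

Lemma tens_image_submodule : submodule (tens_image phi N).
Proof.
split; first by exists 0 => //; rewrite raddf0.
  by move=> _ _ [z _ <-] [w _ <-]; exists (z + w) => //; rewrite raddfD.
by move=> a _ [z _ <-]; exists (a *: z) => //; rewrite linearZ.
Qed.

Lemma tens_image_min (X : set T) : X 0 -> (forall z w, X z -> X w -> X (z + w)) ->
  (forall s x, x \in N -> X (tens phi s x)) -> tens_image phi N `<=` X.
Proof.
move=> X0 XD Xt _ [z _ <-]; elim/tens_elim: z => [|z w Xz Xw|s x].
- by rewrite raddf0.
- by rewrite raddfD; apply: XD.
- by rewrite tens_mapE; apply/Xt/valP.
Qed.

(** Right exactness. For the harder direction, s ⊗ w is sent to the class of s ⊗ x modulo the image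
    of S ⊗ N, where x represents w. Representatives differ by elements of N, so this is well
    defined, and it factors the projection through S ⊗ (M/N). *)
Lemma tens_map_quot_eq0 z :
  tens_map phi (quot_map N) z = 0 <-> tens_image phi N z.
Proof.
split=> [z0|]; last first.
  move: z; apply: tens_image_min; first exact: raddf0.
    by move=> z w; rewrite tens_mapD => -> ->; rewrite addr0.
  by move=> s x Nx; rewrite tens_mapE (quot_map_eq0 N x).2 // tens0r.
have [I IP] := submodule_submodClosed tens_image_submodule.
have tI s x y : x - y \in N ->
    quot_map I (tens phi s x) = quot_map I (tens phi s y).
  move=> Nxy; apply/quot_mapP; rewrite -tensNr -tensDr.
  exact/IP/mem_tens_image.
have [s w w'|s w w'|s r w|g gP] := @tens_lift R S phi (quotmod N) (quotmod I)
  (fun s w => quot_map I (tens phi s (repr w))).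
- by rewrite tensDl raddfD.
- rewrite -raddfD -tensDr; apply/tI/quot_mapP.
  by rewrite raddfD /= !quot_mapK.
- rewrite -tensZr; apply/esym/tI/quot_mapP.
  by rewrite [RHS]linearZ /= !quot_mapK.
apply/IP/quot_map_eq0; suff <- : g (tens_map phi (quot_map N) z) = quot_map I z.
  by rewrite z0 raddf0.
elim/tens_elim: z {z0} => [|z w hz hw|s x]; first by rewrite !raddf0.
  by rewrite tens_mapD !raddfD hz hw.
by rewrite tens_mapE gP; apply/tI/quot_repr.
Qed.

Lemma tens_map_quot_surj w : exists z, w = tens_map phi (quot_map N) z.
Proof.
elim/tens_elim: w => [|_ _ [z ->] [w ->]|s x]; first by exists 0; rewrite raddf0.
  by exists (z + w); rewrite tens_mapD.
by exists (tens phi s (repr x)); rewrite tens_mapE quot_mapK.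
Qed.

End Image.

Section ImageS.
Variables (R S : comNzRingType) (phi : {rmorphism R -> S}) (M : lmodType R).
Implicit Types N Q : submodClosed M.

Lemma tens_imageS N Q : {subset N <= Q} ->
  tens_image phi N `<=` tens_image phi Q.
Proof.
have [Q0 QD _] := tens_image_submodule phi Q.
by move=> NQ; apply: tens_image_min => // s x /NQ; apply: mem_tens_image.
Qed.

Lemma extended_tens_image N (L : set M) : (forall x, (x \in N) <-> L x) ->
  extended phi L = tens_image phi N.
Proof.
move=> NL; have [N0 ND NZ] := tens_image_submodule phi N.
apply/seteqP; split.
  apply: finite_sums_min => // _ [s _ [x /NL Nx <-]].
  by rewrite tensZl; apply: mem_tens_image.
apply: tens_image_min; [exact: finite_sums0 | exact: finite_sumsD |].
move=> s x /NL Lx; apply: mem_finite_sums; exists s => //; exists x => //.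
by rewrite tensZl mulr1.
Qed.

(** For J = m^k this translates level k of the adic closure: the preimage of J(S ⊗ M/N) in S ⊗ M is
    the image of S ⊗ N plus J(S ⊗ M). *)
Lemma mulset_tens_quot N Q (J : set R) z :
  (forall x, (x \in Q) <-> [set x + y | x in [set` N] & y in mulset J M] x) ->
  mulset (phi @` J) _ (tens_map phi (quot_map N) z) <-> tens_image phi Q z.
Proof.
move=> QP; have [Q0 QD QZ] := tens_image_submodule phi Q.
have NQ : {subset N <= Q}.
  move=> x Nx; apply/QP; exists x => //; exists 0; last by rewrite addr0.
  exact: finite_sums0.
have JQ a x : J a -> a *: x \in Q.
  move=> Ja; apply/QP; exists 0; rewrite /= ?rpred0 //.
  exists (a *: x); last by rewrite add0r.
  by apply: mem_finite_sums; exists a => //; exists x.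
split.
  (* Quantifying over all lifts y lets the induction on the sum subtract one term at a time; the
     empty sum is right exactness. *)
  have /(_ (tens_map phi (quot_map N) z)) :
      mulset (phi @` J) (tensor phi (quotmod N)) `<=`
      [set w | forall y, tens_map phi (quot_map N) y = w -> tens_image phi Q y].
    move=> _ [s [sJ ->]]; elim: s sJ => [|w s ih] sJ y.
      by rewrite big_nil => /tens_map_quot_eq0; apply: tens_imageS.
    rewrite big_cons => yP.
    have [_ [a Ja <-] [w' _ wP]] := sJ w (mem_head _ _).
    have [w1 w1P] := tens_map_quot_surj w'.
    rewrite -(subrK (phi a *: w1) y); apply: (QD).
      apply: ih => [v vs|]; first by apply: sJ; rewrite inE vs orbT.
      by rewrite tens_mapB tens_mapZ yP -w1P wP addrAC subrr add0r.
    elim/tens_elim: w1 {w1P} => [|u v Qu Qv|t x]; first by rewrite scaler0.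
      by rewrite scalerDr; apply: QD.
    by rewrite tensZl mulrC -tensZr; apply/mem_tens_image/JQ.
  by move=> h /h; apply.
move: z; apply: tens_image_min.
- by rewrite raddf0; apply: finite_sums0.
- by move=> z w hz hw; rewrite tens_mapD; apply: finite_sumsD.
move=> s x /QP[y Ny [_ [r [rJ ->]] <-]].
rewrite tens_mapE quot_mapD (quot_map_eq0 N y).2 // add0r.
elim: r rJ => [|v r ih] rJ.
  by rewrite big_nil raddf0 tens0r; apply: finite_sums0.
rewrite big_cons quot_mapD tensDr; apply: finite_sumsD; last first.
  by apply: ih => w wr; apply: rJ; rewrite inE wr orbT.
have [a Ja [w _ <-]] := rJ v (mem_head _ _).
apply: mem_finite_sums; exists (phi a); first by exists a.
exists (tens phi s (quot_map N w)) => //.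
by rewrite quot_mapZ tensZr tensZl mulrC.
Qed.

End ImageS.

(** * Transfer of ring properties to R_m *)

Section Localization.
Variables (R : comNzRingType) (m : prime_idealr R).
Local Notation L := (locring m).

Lemma lfracE a (s : denom m) : lfrac a s = lfrac 1 s * to_locring m a.
Proof. by rewrite lfrac_mulE; apply/lfracP; exists (denom1 m) => /=; ring. Qed.

Lemma to_locringE a (s : denom m) :
  to_locring m a = to_locring m (val s) * lfrac a s.
Proof. by rewrite lfrac_mulE; apply/lfracP; exists (denom1 m) => /=; ring. Qed.

Lemma lfrac_unit (s : denom m) : lfrac 1 s * to_locring m (val s) = 1.
Proof. by rewrite lfrac_mulE; apply/lfracP; exists (denom1 m) => /=; ring. Qed.

Lemma to_locring_eq0 a : to_locring m a = 0 <-> exists w : denom m, val w * a = 0.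
Proof.
split=> [/lfracP[w] /=|[w wa]]; first by rewrite !mulr0 mul1r; exists w.
by apply/lfracP; exists w; rewrite /= !mulr0 mul1r.
Qed.

Lemma ideal_lfrac (I : set L) a s : ideal I -> I (lfrac a s) <-> I (to_locring m a).
Proof.
case=> _ _ IZ; split=> [Ias|Ia]; first by rewrite (to_locringE a s); apply: IZ.
by rewrite lfracE; apply: IZ.
Qed.

Lemma ideal_contraction (I : set L) : ideal I -> ideal [set a | I (to_locring m a)].
Proof.
case=> I0 ID IZ; split; rewrite /= ?rmorph0 //.
  by move=> a b Ia Ib; rewrite rmorphD; apply: ID.
by move=> a b Ib; rewrite rmorphM; apply: IZ.
Qed.

(** Denominators are units, so an ideal of R_m is determined by its contraction, and a maximal
    contraction comes from a maximal ideal of the family. *)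
Lemma locring_max_condition : max_condition R -> max_condition L.
Proof.
move=> maxR F Fid [I0 FI0].
pose ctr (I : set L) : set R := [set a | I (to_locring m a)].
have [_ [I FI <-]||_ [I FI <-] Imax] := maxR (ctr @` F).
- exact/ideal_contraction/Fid.
- by exists (ctr I0); exists I0.
exists I => // J FJ IJ; elim/lfrac_ind=> a s.
move=> /(ideal_lfrac a s (Fid _ FJ)) Ja; apply/(ideal_lfrac a s (Fid _ FI)).
by apply: (Imax (ctr J)) => [|b|]; [exists J | exact: IJ | exact: Ja].
Qed.

Lemma locring_reduced : is_reduced R -> is_reduced L.
Proof.
move=> redR; elim/lfrac_ind=> a s n an.
have /to_locring_eq0[w wan] : to_locring m (a ^+ n) = 0.
  by rewrite rmorphXn [X in X ^+ _](to_locringE a s) exprMn an mulr0.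
suff wa : val w * a = 0.
  by rewrite lfracE (to_locring_eq0 a).2 ?mulr0 //; exists w.
(* The exponent n + 1 leaves a factor w for a^n even when n = 0. *)
apply: (@redR _ n.+1); rewrite exprMn exprSr [a ^+ n.+1]exprS.
by rewrite mulrACA wan mulr0.
Qed.

(** A minimal prime P' of R_m contracts to a minimal prime P of R: a prime Q inside P misses all
    denominators, so it extends to a prime of R_m inside P', which must be P', and contracting back
    gives P inside Q. *)
Lemma off_minimal_primes_loc c :
  off_minimal_primes c -> off_minimal_primes (to_locring m c).
Proof.
move=> offc P' P'min.
have iP' := prime_idealr_ideal P'.
have [|||P PP] := @prime_of_set R [set a | to_locring m a \in P'].
- exact: (ideal_contraction iP').
- by rewrite /= rmorph1 idealr1.
- by move=> a b; rewrite /= rmorphM prime_idealrM => /orP.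
have Pm a : a \in P -> a \in m.
  move=> /PP Pa; apply: contraT => na; have := idealr1 P'.
  rewrite -(lfrac_unit (Sub a na : denom m)) idealMr //.
suff : c \notin P by apply: contra => /PP.
apply: offc => Q QP.
have [|||Q' Q'P] := @prime_of_set L
    [set z | exists2 a, a \in Q & exists s, z = lfrac a s].
- split; first by exists 0; rewrite ?rpred0 //; exists (denom1 m).
    move=> _ _ [a Qa [s ->]] [b Qb [t ->]].
    rewrite lfrac_addE; eexists; last by eexists.
    by rewrite rpredD // idealMr.
  elim/lfrac_ind=> a s _ [b Qb [t ->]].
  rewrite -[_ *: _]/(_ * _) lfrac_mulE; eexists; last by eexists.
  exact: idealMr.
- move=> [a Qa [s /lfracP[w /=]]]; rewrite mul1r mulr1 => ws.
  have : val w * val s \in Q by rewrite ws idealMr.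
  rewrite prime_idealrM => /orP[]/QP/Pm h; [move: (valP w) | move: (valP s)];
    by rewrite /= h.
- elim/lfrac_ind=> a s; elim/lfrac_ind=> b t [c' Qc [u]].
  rewrite lfrac_mulE => /lfracP[w /= e].
  have : val w * (val u * (a * b)) \in Q by rewrite e !idealMr.
  have nQ (v : denom m) : (val v \in Q) = false.
    by apply/negP => /QP/Pm h; move: (valP v); rewrite /= h.
  rewrite !prime_idealrM !nQ /= => /orP[Qa|Qb]; [left|right].
    by exists a => //; exists s.
  by exists b => //; exists t.
have Q'P' : {subset Q' <= P'}.
  move=> _ /Q'P[a /QP/PP /= Pa [s ->]].
  exact: (ideal_lfrac a s iP').2.
move=> a /PP /(P'min Q' Q'P') /Q'P[b Qb [s /lfracP[w /= e]]].
have : val w * (val s * a) \in Q by rewrite e mul1r idealMr.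
have nQ (v : denom m) : (val v \in Q) = false.
  by apply/negP => /QP/Pm h; move: (valP v); rewrite /= h.
by rewrite !prime_idealrM !nQ.
Qed.

Section Module.
Variable M : lmodType R.

Lemma loc_inD (x y : M) : loc_in m (x + y) = loc_in m x + loc_in m y.
Proof.
by rewrite frac_addE; apply/fracP; exists (denom1 m); rewrite /= mulr1 !scale1r.
Qed.

Lemma loc_inZ a (x : M) : loc_in m (a *: x) = to_locring m a *: loc_in m x.
Proof.
by rewrite frac_scaleE; apply/fracP; exists (denom1 m); rewrite /= mulr1.
Qed.

Lemma fracE (x : M) (s : denom m) : frac x s = lfrac 1 s *: loc_in m x.
Proof.
rewrite frac_scaleE; apply/fracP; exists (denom1 m).
by rewrite /= mulr1 !scale1r.
Qed.

Lemma lspan_loc_in (s : seq M) x :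
  lspan s x -> lspan [seq loc_in m y | y <- s] (loc_in m x).
Proof.
have [s0 sD sZ] := lspan_submodule [seq loc_in m y | y <- s].
have sub : submodule [set x | lspan [seq loc_in m y | y <- s] (loc_in m x)].
  split=> [|y z|a y]; first exact: s0.
    by rewrite /= loc_inD; apply: sD.
  by rewrite /= loc_inZ; apply: sZ.
move=> sx; apply: (lspan_sub sub _ sx) => y ys.
exact/mem_lspan/map_f.
Qed.

Lemma fingen_loc : fingen M -> fingen (loc m M).
Proof.
move=> [g gP]; exists [seq loc_in m y | y <- g]; elim/frac_ind=> x s.
have [_ _ sZ] := lspan_submodule [seq loc_in m y | y <- g].
by rewrite fracE; apply/sZ/lspan_loc_in/gP.
Qed.

Lemma fingen_loc_sub (N : submodClosed M) :
  fingen (submod N) -> fingen (submod (loc_sub m N : submodClosed _)).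
Proof.
move=> /fingen_submodP[g [gN gP]]; apply/fingen_submodP.
exists [seq loc_in m y | y <- g]; split.
  by move=> _ /mapP[y /gN Ny ->]; apply/loc_subP; exists y => //; exists (denom1 m).
have [_ _ sZ] := lspan_submodule [seq loc_in m y | y <- g].
move=> _ /loc_subP[x /gP gx [s ->]].
by rewrite fracE; apply/sZ/lspan_loc_in.
Qed.

End Module.

Definition denomX (s : denom m) (n : nat) : denom m := iter n (denomM s) (denom1 m).

Lemma val_denomX s n : val (denomX s n) = val s ^+ n.
Proof. by elim: n => //= n ih; rewrite exprS -ih. Qed.

End Localization.

(** * Frobenius powers and localization *)

Section FrobeniusLocalization.
Variables (p : nat) (R : comNzRingType) (chR : p \in [pchar R]).
Variables (m : prime_idealr R) (M : lmodType R) (e : nat).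
Local Notation chL := (locring_pchar m chR).
Local Notation FM := (tensor (frob chR e) M).
Implicit Types N : submodClosed M.

Lemma frob_tensZ s r (x : M) :
  tens (frob chR e) s (r *: x) = tens (frob chR e) (s * r ^+ (p ^ e)) x.
Proof. exact: tensZr. Qed.

Lemma frob_sub_loc N c u : frob_sub chR e N (c *: frob_in chR e u) ->
  frob_sub chL e (loc_sub m N) (to_locring m c *: frob_in chL e (loc_in m u)).
Proof.
have [s t x|s x y|s r x|f fP] := @tens_lift R R (frob chR e) M
  (tensor (frob chL e) (loc m M))
  (fun s x => tens (frob chL e) (to_locring m s) (loc_in m x)).
- by rewrite rmorphD tensDl.
- by rewrite loc_inD tensDr.
- rewrite loc_inZ tensZr; congr tens.
  by rewrite rmorphM; congr (_ * _); apply: rmorphXn.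
have [I0 ID _] := tens_image_submodule (frob chL e) (loc_sub m N).
have fN : tens_image (frob chR e) N `<=`
    [set z | tens_image (frob chL e) (loc_sub m N) (f z)].
  apply: tens_image_min => [|z w hz hw|s x Nx]; rewrite /= ?raddf0 //.
    by rewrite raddfD; apply: ID.
  rewrite fP; apply/mem_tens_image/loc_subP.
  by exists x => //; exists (denom1 m).
by move=> /fN; rewrite /= /frob_in !tensZl fP !mulr1.
Qed.

(** The map a/s ⊗ x/t to (a ⊗ x)/(s t^q), from F^e(M_m) to the localization of F^e(M), sends the
    image of F^e(N_m) to fractions with numerator in N^[q]. Clearing denominators in the latter
    module produces t. *)
Lemma frob_sub_unloc N c (s : denom m) u :
  frob_sub chL e (loc_sub m N) (lfrac c s *: frob_in chL e (loc_in m u)) ->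
  exists2 t, t \notin m & frob_sub chR e N (t *: (c *: frob_in chR e u)).
Proof.
pose q := (p ^ e)%N.
pose b (z : locring m) (w : loc m M) : loc m FM :=
  frac (tens (frob chR e) (lfrac_num z) (repr w).1)
       (denomM (lfrac_den z) (denomX (repr w).2 q)).
have bE a s' x t : b (lfrac a s') (frac x t) =
    frac (tens (frob chR e) a x) (denomM s' (denomX t q)).
  have [w wP] := lfrac_repr a s'; have [w' w'P] := frac_repr x t.
  rewrite /b; move: (lfrac_num _) (lfrac_den _) (repr _) wP w'P => a1 s1 [x1 t1].
  (* Scalars of the module factor cross the tensor sign as q-th powers, hence w'^q in the
     multiplier. *)
  move=> /= wP w'P; apply/fracP; exists (denomM w (denomX w' q)).
  rewrite /= !val_denomX !tensZl.
  transitivity (tens (frob chR e) (val w * (val s' * a1))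
                  (val w' *: (val t *: x1))).
    by rewrite scalerA frob_tensZ exprMn -/q; congr tens => /=; ring.
  by rewrite wP w'P scalerA frob_tensZ exprMn -/q; congr tens => /=; ring.
have [z1 z2 w|z w1 w2|z r w|f fP] := @tens_lift _ _ (frob chL e) (loc m M) _ b.
- elim/lfrac_ind: z1 => a s1; elim/lfrac_ind: z2 => a' s2.
  elim/frac_ind: w => x t; rewrite lfrac_addE !bE frac_addE; apply/fracP.
  exists (denom1 m); rewrite /= !val_denomX !scale1r !scalerDr !tensZl -!tensDl.
  by congr tens => /=; ring.
- elim/lfrac_ind: z => a s1; elim/frac_ind: w1 => x t1; elim/frac_ind: w2 => y t2.
  rewrite frac_addE !bE frac_addE; apply/fracP.
  exists (denom1 m); rewrite /= !val_denomX /= !exprMn !scale1r tensDr !scalerDr.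
  by rewrite !tensZl !frob_tensZ -/q; congr (tens _ _ _ + tens _ _ _) => /=; ring.
- elim/lfrac_ind: z => a s1; elim/lfrac_ind: r => a' s2.
  elim/frac_ind: w => x t; rewrite frac_scaleE bE.
  rewrite (_ : _ * _ = lfrac a s1 * lfrac (a' ^+ q) (denomX s2 q)); last first.
    congr (_ * _); rewrite /= /frob -/q; elim: (q) => [//|n ih].
    rewrite exprS ih lfrac_mulE.
    by apply/lfracP; exists (denom1 m) => /=; rewrite exprS.
  rewrite lfrac_mulE bE; apply/fracP; exists (denom1 m).
  rewrite /= !val_denomX /= exprMn frob_tensZ -/q !tensZl; congr tens => /=; ring.
have [I0 ID IZ] := tens_image_submodule (frob chR e) N.
have fN : tens_image (frob chL e) (loc_sub m N) `<=`
    [set z | exists2 y, tens_image (frob chR e) N y & exists d, f z = frac y d].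
  apply: tens_image_min => /=.
  - by exists 0 => //; exists (denom1 m); rewrite raddf0.
  - move=> z w [y Iy [d ze]] [y' Iy' [d' we]].
    exists (val d' *: y + val d *: y'); first by apply: ID; apply: IZ.
    by exists (denomM d d'); rewrite raddfD /= ze we frac_addE.
  - move=> z w /loc_subP[x Nx [t ->]]; elim/lfrac_ind: z => a s'.
    exists (tens (frob chR e) a x); first exact: mem_tens_image.
    by eexists; rewrite fP bE.
move=> /fN[y Iy [d]]; rewrite /frob_in tensZl mulr1 fP bE => /fracP[w].
rewrite scalerA /= => ey; exists (val w * val d).
  by rewrite prime_idealrM negb_or (valP w) (valP d).
rewrite /frob_sub -[tens _ 1 u]/(frob_in chR e u) /frob_in !tensZl mulr1.
by rewrite -tensZl ey; apply: (IZ _ _ (IZ _ _ Iy)).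
Qed.

End FrobeniusLocalization.

(** Otherwise m + (t) would be proper, hence an [idealr] to which maximality applies. *)
Lemma maximal_inverse (R : comNzRingType) (m : prime_idealr R) t :
  is_maximal m -> t \notin m -> exists r, 1 - r * t \in m.
Proof.
move=> maxm tm; apply: contrapT => nr.
have sI : ideal [set a | exists2 c, c \in m & exists r, a = c + r * t].
  exact: (@submodule_adjoin R R^o [set` m] t (prime_idealr_ideal m)).
pose S : R -> bool := fun a => `[<exists2 c, c \in m & exists r, a = c + r * t>].
have SP a : reflect (exists2 c, c \in m & exists r, a = c + r * t)
  (a \in (S : {pred R})) by exact: asboolP.
have cl : idealr_closed (S : {pred R}).
  have [S0 SD SZ] := sI; split; first exact/SP.
    apply/SP => -[c cm [r e]]; apply: nr; exists r.
    by rewrite e addrK.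
  move=> a x y /SP Sx /SP Sy; apply/SP/SD => //; exact: (SZ a x Sx).
pose I : idealr R := HB.pack S (isIdealr.Build R S cl).
have mI : {subset m <= I}.
  by move=> a am; apply/SP; exists a => //; exists 0; rewrite mul0r addr0.
case/negP: tm; apply: (maxm I mI); apply/SP.
by exists 0; rewrite ?rpred0 //; exists 1; rewrite mul1r add0r.
Qed.

(** * Frobenius powers of submodules with m-coprimary quotient *)

Section Coprimary.
Variables (p : nat) (R : comNzRingType) (chR : p \in [pchar R]).
Variables (m : prime_idealr R) (maxm : is_maximal m).
Variables (M : lmodType R) (e : nat).

(* Elements outside [m] act bijectively on F^e(M)/Q^[q] when a power of [m]
   kills M/Q. *)
Lemma frob_sub_coprimary (Q : submodClosed M) k t z :
  (forall a x, ideal_power [set` m] k a -> a *: x \in Q) ->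
  t \notin m -> frob_sub chR e Q (t *: z) -> frob_sub chR e Q z.
Proof.
move=> kQ tm Qtz; have [r rtm] := maximal_inverse maxm tm.
have [I0 ID IZ] := tens_image_submodule (frob chR e) Q.
(* With a = 1 - r t in m, the scalar a^(k q) enters the module factor as a^k, which maps M into Q.
   Being 1 modulo t, it recovers z from t z. *)
have [v vP] : exists v, (1 - r * t) ^+ (k * p ^ e) = 1 - v * t.
  elim: (_ * _)%N => [|n [v vP]]; first by exists 0; rewrite mul0r subr0.
  by exists (v + r - r * t * v); rewrite exprS vP; ring.
have -> : z = (1 - r * t) ^+ (k * p ^ e) *: z + v *: (t *: z).
  by rewrite vP scalerA -scalerDl subrK scale1r.
apply: (ID); last exact: IZ.
elim/tens_elim: z {Qtz} => [|z w Iz Iw|s x]; first by rewrite scaler0.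
  by rewrite scalerDr; apply: ID.
rewrite tensZl mulrC exprM -frob_tensZ.
exact/mem_tens_image/kQ/ideal_power_exp.
Qed.

(** Prepares the input of Krull's theorem: s ⊗ a w = a^q s ⊗ w, and a^q stays in the ideal m^k
    because q is positive. *)
Lemma frob_sub_decomp (N Q : submodClosed M) k z :
  (forall x, (x \in Q) <->
     [set x + y | x in [set` N] & y in mulset (ideal_power [set` m] k) M] x) ->
  frob_sub chR e Q z ->
  exists2 b, frob_sub chR e N b &
    mulset (ideal_power [set` m] k) (tensor (frob chR e) M) (z - b).
Proof.
move=> QP; have [I0 ID IZ] := tens_image_submodule (frob chR e) N.
move: z; apply: tens_image_min.
- by exists 0; rewrite // subrr; apply: finite_sums0.
- move=> z w [b Ib hb] [c Ic hc]; exists (b + c); first exact: ID.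
  by rewrite opprD addrACA; apply: finite_sumsD.
move=> s x /QP[y Ny [_ [r [rJ ->]] <-]].
exists (tens (frob chR e) s y); first exact: mem_tens_image.
rewrite tensDr addrC addKr.
elim: r rJ => [|v r ih] rJ; first by rewrite big_nil tens0r; apply: finite_sums0.
rewrite big_cons tensDr; apply: finite_sumsD; last first.
  by apply: ih => w wr; apply: rJ; rewrite inE wr orbT.
have [a Ja [w _ <-]] := rJ v (mem_head _ _).
apply: mem_finite_sums; exists (a ^+ (p ^ e)).
  have [_ _ JZ] := ideal_power_ideal k (prime_idealr_ideal m).
  rewrite -(@prednK (p ^ e)%N) ?expn_gt0 ?prime_gt0 ?(pcharf_prime chR) //.
  by rewrite exprSr; apply: JZ.
by exists (tens (frob chR e) s w) => //; rewrite frob_tensZ tensZl mulrC.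
Qed.

End Coprimary.

(** * The submodules N + m^k M *)

Section PowerSubmodule.
Variables (R : comNzRingType) (noethR : is_noetherian R) (m : prime_idealr R).
Variables (M : lmodType R) (N : submodClosed M).
Hypotheses (fgM : fingen M) (fgN : fingen (submod N)).

(** Finite generation is explicit: generators of N, together with the products of generators of the
    ideal m^k and of M. *)
Lemma add_power_submodule k : exists Q : submodClosed M,
  [/\ forall x, (x \in Q) <->
        [set x + y | x in [set` N] & y in mulset (ideal_power [set` m] k) M] x,
      {subset N <= Q},
      forall a x, ideal_power [set` m] k a -> a *: x \in Q &
      fingen (submod Q) /\ is_coprimary m (quotmod Q)].
Proof.
set J := ideal_power [set` m] k.
have iJ : ideal J := ideal_power_ideal k (prime_idealr_ideal m).
have sJM : submodule (mulset J M).
  apply: finite_sums_submodule => a _ [b Jb [w _ <-]].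
  exists (a * b); first by case: iJ => _ _; apply.
  by exists w => //; rewrite scalerA.
have [J0 JD JZ] := sJM.
have sQ : submodule [set x + y | x in [set` N] & y in mulset J M].
  split; first by exists 0; rewrite /= ?rpred0 //; exists 0; rewrite ?addr0.
    move=> _ _ [x Nx [y Jy <-]] [x' Nx' [y' Jy' <-]].
    exists (x + x'); first exact: rpredD.
    by exists (y + y'); [exact: JD | rewrite addrACA].
  move=> a _ [x Nx [y Jy <-]]; exists (a *: x); first exact: rpredZ.
  by exists (a *: y); [exact: JZ | rewrite scalerDr].
have [Q QP] := submodule_submodClosed sQ.
have NQ : {subset N <= Q}.
  by move=> x Nx; apply/QP; exists x => //; exists 0; rewrite ?addr0.
have JQ a x : J a -> a *: x \in Q.
  move=> Ja; apply/QP; exists 0; rewrite /= ?rpred0 //.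
  exists (a *: x); last by rewrite add0r.
  by apply: mem_finite_sums; exists a => //; exists x.
exists Q; split=> //; split; last first.
  split; last first.
    exists k => a v Ja; rewrite -(quot_mapK v) -quot_mapZ.
    exact/quot_map_eq0/JQ.
  have [g gP] := fgM; exists [seq quot_map Q x | x <- g] => v.
  have [c e] := gP (repr v); exists c; rewrite -[LHS]quot_mapK e raddf_sum.
  rewrite size_map; apply: eq_bigr => i _.
  by rewrite (nth_map 0) // -quot_mapZ.
have [I IP] := submodule_submodClosed iJ.
have /fingen_submodP[s [sI gs]] := noethR I.
have [g gP] := fgM.
have /fingen_submodP[h [hN gh]] := fgN.
apply/fingen_submodP; exists (h ++ [seq a *: x | a <- s, x <- g]); split.
  move=> x; rewrite mem_cat => /orP[/hN/NQ //|/allpairsP[[a w] [/= sa _ ->]]].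
  exact/JQ/IP/sI.
set l := h ++ _; have [l0 lD lZ] := lspan_submodule l.
move=> _ /QP[x Nx [y Jy <-]]; apply: (lD).
  apply: lspan_sub (lspan_submodule l) _ _ (gh x Nx) => z hz.
  by apply: mem_lspan; rewrite mem_cat hz.
move: y Jy; apply: finite_sums_min => // _ [a Ja [w _ <-]].
have sub : ideal [set a | lspan l (a *: w)].
  split; rewrite /= ?scale0r //; first by move=> b c; rewrite scalerDl; apply: lD.
  move=> b c.
  by rewrite -[_ *: (_ : R^o)]/(_ * _) -scalerA; apply: lZ.
apply: (lspan_sub sub _ (gs a _)); last exact/IP.
move=> b sb; have [c ->] := gP w; rewrite /= scaler_sumr.
apply: submodule_sum (lspan_submodule l) _ => i _.
rewrite scalerA mulrC -scalerA; apply/lZ/mem_lspan.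
by rewrite mem_cat allpairs_f ?orbT // mem_nth.
Qed.

End PowerSubmodule.

(** * Frobenius closure as the closure defined by the perfect closure *)

Section PerfectClosure.
Variables (p : nat) (R S : comNzRingType) (chR : p \in [pchar R]).
Variables (iota : {rmorphism R -> S}) (perf : is_perfect_closure p iota).
Variable M : lmodType R.

Lemma frobenius_expr_inj e (x y : S) : x ^+ (p ^ e) = y ^+ (p ^ e) -> x = y.
Proof.
have [_ redS _ _] := perf; have chS := rmorph_pchar iota chR.
move=> exy; apply/eqP; rewrite -subr_eq0; apply/eqP/(@redS _ (p ^ e)%N).
by rewrite -[LHS]/(frob chS e (x - y)) rmorphB /= /frob exy subrr.
Qed.

(** In S q-th roots are unique, hence additive and multiplicative, so a ⊗ x to a^(1/q) ⊗ x is well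
    defined from F^e(M) to S ⊗ M; it sends u^q to 1 ⊗ u. *)
Lemma frobenius_sub_tens_closure (N : submodClosed M) :
  frobenius_closure chR N `<=` tens_closure iota N.
Proof.
have [_ _ root _] := perf; have chS := rmorph_pchar iota chR.
move=> u [e ue]; have /choice[g gP] := root^~ e.
have frobS x y : (x + y : S) ^+ (p ^ e) = x ^+ (p ^ e) + y ^+ (p ^ e).
  by rewrite -[LHS]/(frob chS e (x + y)) rmorphD.
have [a b x|a x y|a r x|f fP] := @tens_lift R R (frob chR e) M
  (tensor iota M) (fun a x => tens iota (g a) x).
- rewrite -tensDl; congr tens; apply: (@frobenius_expr_inj e).
  by rewrite frobS !gP rmorphD.
- exact: tensDr.
- rewrite tensZr; congr tens; apply: (@frobenius_expr_inj e).
  by rewrite exprMn !gP rmorphM; congr (_ * _); apply: rmorphXn.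
have [I0 ID IZ] := tens_image_submodule iota N.
have fN : tens_image (frob chR e) N `<=` [set z | tens_image iota N (f z)].
  apply: tens_image_min => [|z w hz hw|s x Nx]; rewrite /= ?raddf0 //.
    by rewrite raddfD; apply: ID.
  by rewrite fP; apply: mem_tens_image.
have := fN _ ue; rewrite /= fP (_ : g 1 = 1) //.
by apply: (@frobenius_expr_inj e); rewrite gP rmorph1 expr1n.
Qed.

(** By additivity of Frobenius the elements with this property form a subring containing all roots.
    Asking for every large e lets finitely many bounds be merged by a maximum. *)
Lemma perfect_closure_root (x : S) :
  exists e0, forall e, (e0 <= e)%N -> exists r, iota r = x ^+ (p ^ e).
Proof.
have [_ _ _ gen] := perf; have chS := rmorph_pchar iota chR.
pose B : {pred S} := fun x => `[<exists e0, forall e, (e0 <= e)%N ->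
  exists r, iota r = x ^+ (p ^ e)>].
have BP y : reflect (exists e0, forall e, (e0 <= e)%N ->
  exists r, iota r = y ^+ (p ^ e)) (y \in B) by exact: asboolP.
have cl : GRing.subring_closed B.
  split; first by apply/BP; exists 0%N => e _; exists 1; rewrite rmorph1 expr1n.
    move=> y z /BP[e1 h1] /BP[e2 h2]; apply/BP; exists (maxn e1 e2) => e.
    rewrite geq_max => /andP[/h1[r hr] /h2[s hs]]; exists (r - s).
    by rewrite rmorphB hr hs -[RHS]/(frob chS e (y - z)) rmorphB.
  move=> y z /BP[e1 h1] /BP[e2 h2]; apply/BP; exists (maxn e1 e2) => e.
  rewrite geq_max => /andP[/h1[r hr] /h2[s hs]]; exists (r * s).
  by rewrite rmorphM hr hs exprMn.
pose B' : subringClosed S := HB.pack B (GRing.isSubringClosed.Build S B cl).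
apply/BP; apply: (gen B') => y r e yr; apply/BP; exists e => e' lee'.
exists (r ^+ (p ^ (e' - e))).
by rewrite rmorphXn -yr -exprM -expnD subnKC.
Qed.

(* A derivation of a relation in S ⊗ W involves finitely many elements of S,
   all of which become elements of R after raising to a large power q. *)
Lemma tens_rel_frob (W : lmodType R) (a b : seq (S * W)) :
  tens_rel iota a b ->
  exists e0, forall e, (e0 <= e)%N -> forall g : S -> R,
    (forall x, (exists r, iota r = x ^+ (p ^ e)) ->
       iota (g x) = x ^+ (p ^ e)) ->
    tens_rel (frob chR e) [seq (g u.1, u.2) | u <- a] [seq (g u.1, u.2) | u <- b].
Proof.
have [inj_iota _ _ _] := perf; have chS := rmorph_pchar iota chR.
have frobS e x y : (x + y : S) ^+ (p ^ e) = x ^+ (p ^ e) + y ^+ (p ^ e).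
  by rewrite -[LHS]/(frob chS e (x + y)) rmorphD.
elim=> {a b} [a|a b _ [e0 h]|b a c _ [e1 h1] _ [e2 h2]|a a' b b' _ [e1 h1] _ [e2 h2]
  |a b|x|s t x|s x y|s r x].
- by exists 0%N => e _ g _; apply: tens_refl.
- by exists e0 => e le g hg; apply/tens_sym/h.
- exists (maxn e1 e2) => e; rewrite geq_max => /andP[l1 l2] g hg.
  by apply: (@tens_trans _ _ _ _ [seq (g u.1, u.2) | u <- b]); [apply: h1 | apply: h2].
- exists (maxn e1 e2) => e; rewrite geq_max => /andP[l1 l2] g hg.
  by rewrite !map_cat; apply: tens_cat; [apply: h1 | apply: h2].
- by exists 0%N => e _ g _; rewrite !map_cat; apply: tens_catC.
- exists 0%N => e _ g hg /=; rewrite (_ : g 0 = 0); first exact: tens_zero.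
  have q0 : (0 : S) ^+ (p ^ e) = iota 0.
    by rewrite rmorph0 -[LHS]/(frob chS e 0) rmorph0.
  by apply: inj_iota; rewrite hg q0 //; exists 0.
- have [e1 h1] := perfect_closure_root s; have [e2 h2] := perfect_closure_root t.
  exists (maxn e1 e2) => e; rewrite geq_max => /andP[/h1[a ha] /h2[b hb]] g hg /=.
  rewrite (_ : g (s + t) = g s + g t); first exact: tens_Dl.
  apply: inj_iota; rewrite rmorphD !hg ?frobS //; [by exists b|by exists a|].
  by exists (a + b); rewrite rmorphD ha hb.
- by exists 0%N => e _ g _; apply: tens_Dr.
- have [e1 h1] := perfect_closure_root s.
  exists e1 => e /h1[a ha] g hg /=.
  rewrite (_ : g (s * iota r) = g s * frob chR e r); first exact: tens_bal.
  apply: inj_iota; rewrite rmorphM [iota (frob _ _ _)]rmorphXn !hg ?exprMn //.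
    by exists a.
  by exists (a * r ^+ (p ^ e)); rewrite rmorphM ha rmorphXn.
Qed.

(** Gives case (i) the same shape as the other two. *)
Lemma perfect_closure_frobenius (N : submodClosed M) :
  frobenius_closure chR N = tens_closure iota N.
Proof.
have [inj_iota _ _ _] := perf.
apply/seteqP; split; first exact: frobenius_sub_tens_closure.
move=> u /tens_map_quot_eq0; rewrite tens_mapE => /tens_piP/tens_rel_frob[e he].
exists e; apply/tens_map_quot_eq0; rewrite tens_mapE.
(* g is x to x^q where this lies in R, and 0 elsewhere, a default that [tens_rel_frob] leaves
   free. *)
have /choice[g gP] : forall x : S, exists r,
    (exists r, iota r = x ^+ (p ^ e)) -> iota r = x ^+ (p ^ e).
  move=> x; have [[r hr]|n] := pselect (exists r, iota r = x ^+ (p ^ e)).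
    by exists r.
  by exists 0.
have /tens_piP /= := he e (leqnn e) g gP; rewrite (_ : g 1 = 1) //.
by apply: inj_iota; rewrite gP expr1n ?rmorph1 //; exists 1; rewrite rmorph1.
Qed.

End PerfectClosure.

(** * Comparison of tight closure over R and over R_m *)

Section TightClosureLocalization.
Variables (p : nat) (R : comNzRingType) (chR : p \in [pchar R]).
Hypotheses (noethR : is_noetherian R) (redR : is_reduced R).
Variables (m : prime_idealr R) (maxm : is_maximal m).
Variable M : lmodType R.
Local Notation chL := (locring_pchar m chR).
Implicit Types N Q : submodClosed M.

Lemma tight_closureS N Q : {subset N <= Q} ->
  tight_closure chL (loc_sub m N) `<=` tight_closure chL (loc_sub m Q).
Proof.
move=> NQ z [c offc [e0 h]]; exists c => //; exists e0 => e /h.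
apply: tens_imageS => _ /loc_subP[x /NQ Qx [s ->]].
by apply/loc_subP; exists x => //; exists s.
Qed.

(* [c] may vanish at minimal primes outside [m]; adding to it a [d] that dies
   in [R_m] makes it regular without changing its image in [R_m]. *)
Lemma tight_closure_unloc Q k u :
  (forall a x, ideal_power [set` m] k a -> a *: x \in Q) ->
  tight_closure chL (loc_sub m Q) (loc_in m u) -> tight_closure chR Q u.
Proof.
have maxR := noetherian_max_condition noethR.
move=> kQ [z]; elim/lfrac_ind: z => c s offc [e0 h].
have [d cd reg] := regular_completion maxR redR c.
exists (c + d); first exact: regular_off_minimal_primes.
have cds : lfrac c s = lfrac (c + d) s.
  (* c/s lies off the minimal primes of the reduced ring R_m, so it is regular there, and it kills
     d/1. *)
  have d0 : to_locring m d = 0.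
    apply: (off_minimal_primes_regular (locring_max_condition maxR)
      (locring_reduced redR) offc).
    rewrite lfrac_mulE cd; apply/lfracP; exists (denom1 m) => /=; ring.
  by rewrite [RHS]lfracE rmorphD /= d0 addr0 -lfracE.
exists e0 => e /h; rewrite cds => /frob_sub_unloc[t tm fs].
exact: (frob_sub_coprimary maxm kQ tm fs).
Qed.

Lemma tight_closure_bigcap N (Q : nat -> submodClosed M) u :
  fingen M -> (exists c, is_test_element chL c) ->
  (forall k x, (x \in Q k) <->
     [set x + y | x in [set` N] & y in mulset (ideal_power [set` m] k) M] x) ->
  (forall k, fingen (submod (Q k))) ->
  (forall k, tight_closure chR (Q k) u) ->
  tight_closure chL (loc_sub m N) (loc_in m u).
Proof.
move=> fgM [z]; elim/lfrac_ind: z => c s [offc test] QP fgQ uQ.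
have maxR := noetherian_max_condition noethR.
exists (lfrac c s) => //; exists 0%N => e _.
have cuQ k : frob_sub chR e (Q k) (c *: frob_in chR e u).
  have [b offb [e0 hb]] := uQ k.
  (* b and e0 depend on k; in R_m the test element replaces them by c/s and the given e, at the cost
     of a factor t that is cancelled below. *)
  have ut : tight_closure chL (loc_sub m (Q k)) (loc_in m u).
    exists (to_locring m b); first exact: off_minimal_primes_loc.
    by exists e0 => e' /hb; apply: frob_sub_loc.
  have [t tm] := frob_sub_unloc (test _ _ (fingen_loc m fgM)
    (fingen_loc_sub m (fgQ k)) _ ut e).
  apply: (@frob_sub_coprimary p R chR m maxm M e (Q k) k) => // a x ka.
  apply/QP; exists 0; rewrite /= ?rpred0 //; exists (a *: x); last by rewrite add0r.
  by apply: mem_finite_sums; exists a => //; exists x.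
have [||k|t tm ht] := @krull_intersection R m _
  (frob_sub chR e N) (c *: frob_in chR e u) maxR.
- exact: fingen_tensor.
- exact: tens_image_submodule.
- exact: (frob_sub_decomp (QP k) (cuQ k)).
have [_ _ IZ] := tens_image_submodule (frob chL e) (loc_sub m N).
have := ht; rewrite scalerA => /(frob_sub_loc m) fs.
(* Dividing by s t in R_m turns t c u^q into (c/s) u^q. *)
have := IZ (lfrac 1 s * lfrac 1 (Sub t tm : denom m)) _ fs.
rewrite scalerA (_ : _ * to_locring m _ = lfrac c s) //.
by rewrite !lfrac_mulE; apply/lfracP; exists (denom1 m) => /=; ring.
Qed.

End TightClosureLocalization.

Theorem proposition4p6 (p : nat) (R : comNzRingType) (chR : p \in [pchar R])
    (noethR : is_noetherian R) (redR : is_reduced R)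
    (m : prime_idealr R) (maxm : is_maximal m)
    (testRm : exists c, is_test_element (locring_pchar m chR) c)
    (S : comNzRingType) (iota : {rmorphism R -> S})
    (hyp :
      [\/ (* (i) *)
          is_perfect_closure p iota /\
          (forall (P : lmodType R) (Q : submodClosed P),
             fingen P -> fingen (submod Q) -> is_coprimary m (quotmod Q) ->
             frobenius_closure chR Q = tight_closure chR Q),
          (* (ii) *)
          [/\ is_domain R, is_plus_ring iota &
              forall (P : lmodType R) (Q : submodClosed P),
                fingen P -> fingen (submod Q) -> is_coprimary m (quotmod Q) ->
                tens_closure iota Q = tight_closure chR Q]
        | (* (iii) *)
          is_domain R /\
          exists G : nat -> set R,
            [/\ is_grading G, is_plusGR_ring G iota \/ is_plusgr_ring G iota &
                forall (P : lmodType R) (Q : submodClosed P),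
                  fingen P -> fingen (submod Q) -> is_coprimary m (quotmod Q) ->
                  tens_closure iota Q = tight_closure chR Q]])
    (M : lmodType R) (N : submodClosed M)
    (fgM : fingen M) (fgN : fingen (submod N)) :
  (forall u : M,
     tight_closure (locring_pchar m chR) (loc_sub m N) (loc_in m u) <->
     adic_closure0 iota m (tens iota 1 (quot_pi N u))) /\
  (is_free M ->
     [set u | tight_closure (locring_pchar m chR) (loc_sub m N) (loc_in m u)] =
     \bigcap_k [set u | extended iota
                          [set x + y | x in [set` N]
                                     & y in mulset (ideal_power [set` m] k) M]
                          (tens iota 1 u)]).
Proof.
have clE (P : lmodType R) (Q : submodClosed P) : fingen P -> fingen (submod Q) ->
    is_coprimary m (quotmod Q) -> tens_closure iota Q = tight_closure chR Q.
  case: hyp => [[perf h]|[_ _ h]|[_ [G [_ _ h]]]] fgP fgQ cQ; try exact: h.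
  by rewrite -(perfect_closure_frobenius chR perf) h.
have /choice[Q QP] := add_power_submodule noethR m fgM fgN.
(* The pivot of both claims: each right-hand side is this condition read level by level, through
   [mulset_tens_quot] or [extended_tens_image]. *)
have core u : tight_closure (locring_pchar m chR) (loc_sub m N) (loc_in m u) <->
    forall k, tens_image iota (Q k) (tens iota 1 u).
  split=> [uN k|uQ].
    have [_ NQ kQ [fgQ cQ]] := QP k.
    have := tight_closure_unloc noethR redR maxm kQ (tight_closureS NQ uN).
    by rewrite -clE.
  apply: (tight_closure_bigcap noethR maxm fgM testRm (Q := Q)) => k.
  - by case: (QP k).
  - by case: (QP k) => _ _ _ [].
  - by have [_ _ _ [fgQ cQ]] := QP k; rewrite -clE //; apply: uQ.
split=> [u|_].
  rewrite core; have := tens_mapE iota (quot_map N) 1 u => <-.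
  have [QE _ _ _] := QP 0%N.
  split=> h k; have [{}QE _ _ _] := QP k.
    by move=> _; apply/(mulset_tens_quot _ QE).
  by apply/(mulset_tens_quot _ QE); apply: h.
apply/seteqP; split=> u /=.
  move=> /core uQ k _; have [QE _ _ _] := QP k.
  by rewrite /= (extended_tens_image iota QE).
move=> h; apply/core => k; have [QE _ _ _] := QP k.
by rewrite -(extended_tens_image iota QE); apply: h.
Qed.
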